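(* Let $G=(V,E)$ be a finite undirected graph without loops or multi-edges, with positive edge weights $w:E\to\mathbb{R}^+$, whose edges arrive one at a time in an arbitrary order, and let $k>1$ be a constant. The algorithm Shadow Matching$(G,k)$ (described in the context) constructs a matching $M$ of $G$, and if $M^*$ is a matching of $G$ of maximum weight then $$w(M^* )\le\left(k+\frac{k}{k-1}+\frac{k^3-k+1}{k^2}\right)\cdot w(M).$$
   Context: A matching is a set of edges no two of which share a vertex. Two edges are adjacent if they share a vertex. For a set $F$ of edges, $M(F)$ denotes the set of edges of $M$ adjacent to some edge of $F$. An augmenting set is a set of pairwise non-adjacent edges of $E\setminus M$. For a set of edges $F$, $w(F)=\sum_{e\in F}w(e)$. A null-edge is the empty set, of weight $0$; any name below that refers to a nonexistent edge denotes the null-edge (and edges derived from a null-edge are null as well). Algorithm Shadow Matching$(G,k)$: it keeps a matching $M$, initially empty, and for each edge $xy\in M$ and each endpoint $a\in\{x,y\}$ at most one stored edge, denoted shadow-edge$(xy,a)$, which shares the vertex $a$ with $xy$ and is not in $M$. For each input edge $y_1y_2$ in turn: let $g_1y_1$ and $g_2y_2$ be the edges of $M$ covering $y_1$ and $y_2$; let $a_1g_1:=$ shadow-edge$(g_1y_1,g_1)$ and $a_2g_2:=$ shadow-edge$(g_2y_2,g_2)$; let $a_1c_1$ and $a_2c_2$ be the edges of $M$ covering $a_1$ and $a_2$; let $S=\{y_1y_2,g_1y_1,a_1g_1,a_1c_1,g_2y_2,a_2g_2,a_2c_2\}$. Find an augmenting set $A\subseteq S$ maximizing $r(A):=w(A)-k\cdot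 w(M(A))$. If $r(A)>0$, then each edge of $M(A)$ is stored as the shadow-edge of each edge of $A$ adjacent to it (assigned to their common vertex), and $M:=(M\setminus M(A))\cup A$; shadow-edges assigned to edges that leave $M$ are discarded, edges that enter $M$ are no longer shadow-edges, and shadow-edges of edges remaining in $M$ are kept. The output is the matching $M$ after all edges have been read. *)

(* Defs.v *)
From mathcomp Require Import all_boot all_order all_algebra.

Set Implicit Arguments.
Unset Strict Implicit.
Unset Printing Implicit Defensive.

Import Order.TTheory GRing.Theory Num.Theory.
Local Open Scope ring_scope.

(* An edge is the two-element set of its endpoints, so a graph
   without loops or multi-edges on the vertex type T is a set E of two-element
   sets.  The null-edge is [set0]; it never belongs to E, and a quantifier over
   its endpoints is void, so whatever is derived from it is null as well. *)
Definition simple_graph (T : finType) (E : {set {set T}}) : bool :=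
  [forall e in E, #|e| == 2].

Definition adjacent (T : finType) (e f : {set T}) : bool :=
  (e != f) && ~~ [disjoint e & f].

Definition matching (T : finType) (E M : {set {set T}}) : bool :=
  (M \subset E) && [forall e in M, forall f in M, ~~ adjacent e f].

Definition weight (R : realFieldType) (T : finType) (w : {set T} -> R)
    (F : {set {set T}}) : R :=
  \sum_(e in F) w e.

Definition max_weight_matching (R : realFieldType) (T : finType)
    (E : {set {set T}}) (w : {set T} -> R) (M : {set {set T}}) : Prop :=
  matching E M /\
  forall M', matching E M' -> weight w M' <= weight w M.

Definition adjacent_in (T : finType) (M F : {set {set T}}) : {set {set T}} :=
  [set f in M | [exists e in F, adjacent e f]].

Definition augmenting (T : finType) (E M A : {set {set T}}) : bool :=
  (A \subset E :\: M) && [forall e in A, forall f in A, ~~ adjacent e f].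

Definition gain (R : realFieldType) (T : finType) (w : {set T} -> R) (k : R)
    (M A : {set {set T}}) : R :=
  weight w A - k * weight w (adjacent_in M A).

(* The edge of M covering v, null if there is none; it is only used for sets M
   of pairwise non-adjacent edges, where it does not depend on the choice made
   by [pick]. *)
Definition covering (T : finType) (M : {set {set T}}) (v : T) : {set T} :=
  odflt set0 [pick f in M | v \in f].

(* [shadow st f a] is shadow-edge(f, a), null if nothing is stored. *)
Record state (T : finType) : Type := State {
  current : {set {set T}};
  shadow : {set T} -> T -> {set T}
}.

Definition initial (T : finType) : state T := State set0 (fun _ _ => set0).

(* The edges gy, ag, ac reached from the endpoint y of the input edge. *)
Definition branch (T : finType) (st : state T) (y : T) : {set {set T}} :=
  let gy := covering (current st) y in
  gy |: \bigcup_(g in gy :\ y)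
          (let ag := shadow st gy g in
           ag |: [set covering (current st) a | a in ag :\ g]).

Definition candidates (T : finType) (st : state T) (e : {set T}) :
    {set {set T}} :=
  e |: \bigcup_(y in e) branch st y.

Definition optimal (R : realFieldType) (T : finType) (E : {set {set T}})
    (w : {set T} -> R) (k : R) (st : state T) (e : {set T})
    (A : {set {set T}}) : Prop :=
  let admissible B := augmenting E (current st) B && (B \subset candidates st e)
  in admissible A /\
     forall B, admissible B ->
       gain w k (current st) B <= gain w k (current st) A.

Definition augment (T : finType) (st : state T) (A : {set {set T}}) : state T :=
  let M := current st in
  let MA := adjacent_in M A in
  State ((M :\: MA) :|: A)
    (fun f v =>
       if f \in A then (if v \in f then covering MA v else set0)
       else if f \in M :\: MA then
         (if shadow st f v \in A then set0 else shadow st f v)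
       else set0).

(* A relation, because ties between optimal sets are broken arbitrarily. *)
Definition step (R : realFieldType) (T : finType) (E : {set {set T}})
    (w : {set T} -> R) (k : R) (st : state T) (e : {set T}) (st' : state T) :
    Prop :=
  exists2 A, optimal E w k st e A &
    st' = if 0 < gain w k (current st) A then augment st A else st.

Fixpoint run (R : realFieldType) (T : finType) (E : {set {set T}})
    (w : {set T} -> R) (k : R) (st : state T) (s : seq {set T})
    (st' : state T) : Prop :=
  if s is e :: s' then
    exists2 st1, step E w k st e st1 & run E w k st1 s' st'
  else st' = st.

(* M is a possible output when the edges of E arrive in the order s. *)
Definition shadow_matching (R : realFieldType) (T : finType)
    (E : {set {set T}}) (w : {set T} -> R) (k : R) (s : seq {set T})
    (M : {set {set T}}) : Prop :=
  exists2 st, run E w k (initial T) s st & M = current st.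

(* Main.v *)
(* Every endpoint of an edge e of M is charged at most k w(e) for the optimal edge
   covering it, and the charges left on uncovered vertices cost at most
   k / (k - 1) w(M), which gives the factor 2 k + k / (k - 1) of the greedy
   algorithm.  Shadow edges save d = (k - 1) / k^2 per unit of weight.  Let
   e = xy have replaced s = ax, and let an optimal edge arrive at y while a is
   covered by M with weight q.  Rejecting the augmenting set formed by that edge
   and s shows that y is charged at most k w(e) - (w(s) - k q).  On the other
   hand, when a gets covered again with weight q, its charge, which was paid for
   when s left M, is borne by M again up to k q; of this refund (k - 1) q goes to
   e and the rest to the new edge at a.  Either way s is worth (1 - 1/k) w(s) to
   e, and the shadow edges of e weigh w(e) / k together unless e was inserted
   with a surplus. *)

Require Import Defs.
From mathcomp Require Import all_boot all_order all_algebra.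
From mathcomp Require Import lra ring.
Import Order.TTheory GRing.Theory Num.Theory.
Local Open Scope ring_scope.

Set Implicit Arguments.
Unset Strict Implicit.
Unset Printing Implicit Defensive.

(** The bound [k / (k - 1) * weight w M] acts as a potential. Replacing [MA] by [A] raises it by
    [k / (k - 1)] times the gain of [A] plus [k * weight w MA]. So every removed edge [f] brings a
    budget [k * w f] for the charges it leaves behind and for what its successors receive, while the
    gain pays for edges inserted with a surplus. One obstacle is that several shadow edges may lead
    to the same vertex, so that a refund there could be claimed twice. Charges are therefore cut
    into levels, and a shadow edge owns an interval of levels at its far end. Intervals at one
    vertex are disjoint, hence a level that is borne again refunds only one owner. Another obstacle
    is that the shadow edges behind the two ends of an arriving edge may meet and then cannot both
    join it in an augmenting set. [bal_meet] guarantees that in this case one of them has banked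
    enough already. Finally, an arriving edge is charged after the augmentation of its step: which
    sets are augmenting is judged by the old matching, the weights by the new one. *)

Ltac minmax_free t :=
  lazymatch t with
  | context [Order.min _ _] => fail
  | context [Order.max _ _] => fail
  | _ => idtac
  end.

Ltac split_minmax a b :=
  minmax_free a; minmax_free b; let h := fresh in case: (leP a b) => h.

Ltac minmax :=
  repeat match goal with
  | |- context [Order.min ?a ?b] => split_minmax a b
  | |- context [Order.max ?a ?b] => split_minmax a b
  end; try lra.

(** * Weights and levels *)

Section Arithmetic.
Variable R : realFieldType.
Implicit Types p q r f a b k d U V w m W : R.

(** For [q <= r] this is the projection onto the window from [q] to [r]. A difference of two clips
    is the length of the part of an interval inside the window. *)
Definition clip q r w : R := Num.min (Num.max w q) r.

Lemma clip_mono q r w m : m <= w -> clip q r m <= clip q r w.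
Proof. by move=> mw; rewrite /clip; minmax. Qed.

Lemma clip_max q r w p : p <= q -> clip q r (Num.max w p) = clip q r w.
Proof. by move=> pq; rewrite /clip -maxA (max_r pq). Qed.

(** Raising both ends of an interval to at least [r] shortens it by exactly its part in the window
    between [p] and [r]. This is what happens to an interval when the weight at its target rises
    from [p] to [r]. *)
Lemma clip_raise p r m W : p <= m -> m <= W ->
  clip p (Num.max p r) W - clip p (Num.max p r) m
  = (W - m) - (Num.max W r - Num.max m r).
Proof.
rewrite /clip => pm mW; have pW := le_trans pm mW.
rewrite (max_l pm) (max_l pW).
have E x : Num.min x (Num.max p r) = x + Num.max p r - Num.max x (Num.max p r).
  by minmax.
by rewrite !E !maxA (max_l pm) (max_l pW); lra.
Qed.

Lemma clip_rest p r U : clip p (Num.max p r) U - p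
  = Num.max 0 (Num.min r U - Num.min p U).
Proof.
by rewrite /clip; minmax.
Qed.

(** The new interval starts at [p] and stays below [f], and the window pushed above [f] is where the
    older intervals lie. The two parts do not overlap, so both fit below [U]. *)
Lemma clip_stack p q r f U : p <= q -> q <= r -> p < f ->
  (clip (Num.max q f) (Num.max r f) U - Num.max q f)
   + (clip q r (Num.max p (Num.min f U)) - clip q r p) <= clip q r U - q.
Proof.
move=> pq qr pf.
have -> : clip q r p = q by rewrite /clip (max_r pq) min_l.
have mono : clip q r (Num.max p (Num.min f U)) <= clip q r U.
  by rewrite maxC clip_max //; apply: clip_mono; rewrite ge_min lexx orbT.
have low x : x <= q -> clip q r x = q.
  by move=> xq; rewrite /clip (max_r xq) min_l.
case: (leP f q) => fq.
  rewrite (max_l (le_trans fq qr)) (low (Num.max _ _)); first by lra.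
  by rewrite ge_max pq ge_min fq.
case: (leP r f) => rf.
  have -> : clip f f U = f by rewrite /clip min_r // le_max lexx orbT.
  lra.
case: (leP U f) mono => Uf mono.
  have -> : clip f r U = f by rewrite /clip (max_r Uf) (min_l (ltW rf)).
  lra.
rewrite (max_r (ltW pf)) /clip (max_l (ltW Uf)) (max_l (ltW fq)).
rewrite (max_l (ltW (lt_trans fq Uf))) (min_l (ltW rf)); lra.
Qed.

Lemma clip_diff_above f q r m W : q <= r -> f <= m -> f <= W ->
  clip (Num.max q f) (Num.max r f) W - clip (Num.max q f) (Num.max r f) m
  = clip q r W - clip q r m.
Proof.
move=> qr fm fW; case: (leP f q) => fq; first by rewrite (max_l (le_trans fq qr)).
case: (leP r f) => rf.
  have E x : f <= x -> clip q r x = r.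
    by move=> fx; rewrite /clip min_r // le_max (le_trans rf fx).
  have F x : clip f f x = f by rewrite /clip min_r // le_max lexx orbT.
  by rewrite !E // !F !subrr.
have E x : f <= x -> clip q r x = clip f r x.
  by move=> fx; rewrite /clip (max_l fx) (max_l (le_trans (ltW fq) fx)).
by rewrite !E.
Qed.

(** When the weight at a vertex goes from [p] to [r], the uncovered charge grows by the levels lost
    and shrinks by the levels regained. At most one of the two terms is nonzero. *)
Lemma excess_change k p r u : 0 < k ->
  Num.max 0 (u - k * r) - Num.max 0 (u - k * p)
  = k * (Num.max 0 (Num.min p (u / k) - Num.min r (u / k)))
    - k * (Num.max 0 (Num.min r (u / k) - Num.min p (u / k))).
Proof.
move=> k0; have -> : u = k * (u / k) by field; rewrite gt_eqF.
set U := u / k; rewrite -[k * U / k]/(k * U / k).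
have -> : k * U / k = U by field; rewrite gt_eqF.
rewrite -!mulrBr.
have E x : Num.max 0 (k * x) = k * Num.max 0 x.
  by rewrite maxr_pMr ?mulr0 // ltW.
rewrite !E -mulrBr; congr (_ * _).
by minmax.
Qed.

(* [d] is the saving (k - 1) / k ^+ 2, characterized without a division. *)
Definition rate k d : Prop := 1 < k /\ d * k ^+ 2 = k - 1.

Lemma rate_gt0 k d : rate k d -> 0 < d.
Proof.
move=> [k1 dk].
have k2 : 0 < k ^+ 2 by rewrite exprn_gt0 // (lt_trans ltr01).
by rewrite -(pmulr_lgt0 _ k2) dk subr_gt0.
Qed.

Lemma rate_bounds k d : rate k d ->
  d <= 1 /\ d <= k - 1 /\ d * k <= k - 1 /\ d * k <= 1 /\ d <= 1/4.
Proof.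
move=> kd; have d0 := rate_gt0 kd; case: kd => k1 dk.
have dk1 : 0 < d * (k - 1) by rewrite mulr_gt0 // subr_gt0.
have dk2 : 0 < d * (k - 1) ^+ 2 by rewrite mulr_gt0 // exprn_gt0 // subr_gt0.
have h3 : 0 <= (1 - 4 * d) * k ^+ 2.
  by have := sqr_ge0 (k - 2); nra.
have h4 : d <= 1 / 4.
  move: h3; rewrite pmulr_lge0; first by lra.
  by rewrite exprn_gt0 // (lt_trans ltr01).
have h5 : d * k * k = k - 1 by rewrite -mulrA -expr2.
have h6 : 0 <= (1 - d * k) * k by lra.
have h7 : d * k <= 1.
  by move: h6; rewrite pmulr_lge0 ?(lt_trans ltr01) //; lra.
by nra.
Qed.

(* Here and below an edge of weight [f] leaves the matching, [a] and [b] are the new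
   weights at its ends, and [U], [V] are the charges of these ends divided by [k]. *)
Definition released f a U : R := Num.max 0 (Num.min f U - Num.min a U).
Definition heavy f a b : bool := a < f <= b.
(** The bonus goes to the edge at the end of new weight [b]. In the heavy case the budget [k * f]
    has at least [a] to spare after excess and bank are paid. The edge at the light end takes
    [d * a] of it, all that it needs, and the heavy end gets the remaining [(1 - d) * a]. *)
Definition bonus d f a b : R :=
  if heavy f a b then (1 - d) * a else d * Num.min f b.
(** The bank with which the removed edge starts its life as a shadow edge at its heavy end. *)
Definition secured f a b U : R :=
  if heavy f a b then f - (Num.max a (Num.min f U) - a) else 0.

Lemma released_le f a U : a <= f -> 0 <= released f a U <= f - a.
Proof. by rewrite /released => h; minmax. Qed.

Lemma released0 f a U : f <= a -> released f a U = 0.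
Proof. by rewrite /released => h; minmax. Qed.

Lemma bonus_ge0 k d f a b : rate k d -> 0 <= f -> 0 <= a -> 0 <= b -> 0 <= bonus d f a b.
Proof.
move=> kd; have [h1 _] := rate_bounds kd; have h0 := rate_gt0 kd.
rewrite /bonus => f0 a0 b0; case: ifP => _; apply: mulr_ge0; rewrite ?le_min ?f0 //; lra.
Qed.

Lemma half_budget k d f a b U : rate k d -> a < f -> f <= b -> 0 <= a ->
  k * released f a U + (k - 1) * secured f a b U + bonus d f b a + bonus d f a b
   <= k * f.
Proof.
move=> kd af fb a0; rewrite /secured /bonus /heavy af fb /= ltNge fb /=.
rewrite (min_r (ltW af)).
have -> : Num.max a (Num.min f U) - a = released f a U.
  by rewrite /released; minmax.
have := @released_le f a U (ltW af); lra.
Qed.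

(** If one end loses weight, this is [half_budget]. If both do, [k * f <= a + b] limits the loss and
    [d <= k - 1] suffices. If neither does, only two bonuses [d * f] are spent, and the unspent
    [(k - 2 * d) * f] is recorded for use in [topup_total]. *)
Lemma pair_budget k d f a b U V : rate k d -> 0 <= a -> 0 <= b -> 0 < f -> k * f <= a + b ->
  (k * released f a U + bonus d f b a + (k - 1) * secured f b a V)
   + (k * released f b V + bonus d f a b + (k - 1) * secured f a b U)
   <= k * f - (if (f <= a) && (f <= b) then (k - 2 * d) * f else 0).
Proof.
move=> kd a0 b0 f0 kf; have k1 := kd.1.
have [d1 [d2 [d3 [d4 d5]]]] := rate_bounds kd; have d0 := rate_gt0 kd.
case: (leP f a) => fa; case: (leP f b) => fb /=.
- rewrite !released0 // /secured /bonus /heavy !(ltNge _ f) fa fb /=.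
  by rewrite (min_l fa) (min_l fb); lra.
- rewrite subr0 (released0 U) //.
  have -> : secured f a b U = 0 by rewrite /secured /heavy ltNge fa.
  have := @half_budget k d f b a V kd fb fa b0; lra.
- rewrite subr0 (released0 V) //.
  have -> : secured f b a V = 0 by rewrite /secured /heavy ltNge fb.
  have := @half_budget k d f a b U kd fa fb a0; lra.
- have := @released_le f a U (ltW fa); have := @released_le f b V (ltW fb).
  rewrite /secured /bonus /heavy (leNgt f b) (leNgt f a) fa fb /=.
  rewrite (min_r (ltW fa)) (min_r (ltW fb)).
  set x := released _ _ _; set y := released _ _ _ => /andP[x0 xf] /andP[y0 yf].
  have : k * x <= k * (f - b) by rewrite ler_pM2l //; lra.
  have : k * y <= k * (f - a) by rewrite ler_pM2l //; lra.
  have : (k - d) * (k * f) <= (k - d) * (a + b) by rewrite ler_wpM2l //; lra.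
  have : 0 <= (k * (k - 1 - d)) * f by rewrite mulr_ge0 ?mulr_ge0 //; lra.
  lra.
Qed.

(** A level between [p] and [w] either lies above the charge, where it counts [k] times as slack, or
    below it, where it has been regained. Together they give [w - p], and the bonus supplies the
    rest. In the heavy case this uses [a >= k * p - w] and [(1 - d) * k >= 1]. *)
Lemma seen_credit k d p w a u : rate k d -> 0 <= p -> p <= w -> 0 <= a -> k * p <= w + a ->
  d * w <= Num.max 0 (k * w - u) + released w p (u / k) + bonus d p a w.
Proof.
move=> kd p0 pw a0 kp; have k1 := kd.1.
have [d1 [d2 [d3 [d4 d5]]]] := rate_bounds kd; have d0 := rate_gt0 kd.
have -> : u = k * (u / k) by field; rewrite gt_eqF //; lra.
set U := u / k; have -> : k * U / k = U by field; rewrite gt_eqF //; lra.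
have h1 : w - p <= Num.max 0 (k * w - k * U) + released w p U.
  rewrite -mulrBr -[in Num.max _ _](mulr0 k) -maxr_pMr; last lra.
  set x := Num.max 0 (w - U); have x0 : 0 <= x by rewrite /x le_max lexx.
  apply: (le_trans (y := x + released w p U)).
    by rewrite /x /released; minmax.
  by rewrite lerD2r ler_peMl //; lra.
apply: (le_trans (y := w - p + bonus d p a w)); last by rewrite lerD2r.
rewrite /bonus /heavy pw andbT (min_l pw); case: ifP => h.
  have : (1 - d) * (k * p - w) <= (1 - d) * a by rewrite ler_wpM2l //; lra.
  have : 0 <= ((1 - d) * k - 1) * p by rewrite mulr_ge0 //; lra.
  lra.
have : 0 <= (1 - d) * (w - p) by rewrite mulr_ge0 //; lra.
lra.
Qed.

End Arithmetic.

(** * Matchings and augmentations *)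

Section Matchings.
Variables (R : realFieldType) (T : finType) (E : {set {set T}}) (w : {set T} -> R).
Hypothesis simpleE : simple_graph E.
Hypothesis w_gt0 : forall e, e \in E -> 0 < w e.
Implicit Types (e f a : {set T}) (M A : {set {set T}}) (v x y : T).

Definition vweight M v : R := \sum_(e in M | v \in e) w e.

Definition mate M v : T := odflt v [pick x | (x != v) && ([set v; x] \in M)].

Lemma edge_endpoint e v : e \in E -> v \in e ->
  exists2 x, x != v & e = [set v; x].
Proof.
move=> eE ve; have /cards2P[x [y [xy ee]]] := forall_inP simpleE _ eE.
move: ve; rewrite ee !inE => /orP[]/eqP->; first by exists y; rewrite // eq_sym.
by exists x => //; rewrite setUC.
Qed.

Lemma edge_ends e : e \in E -> exists x y, x != y /\ e = [set x; y].
Proof.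
by move=> eE; have /cards2P[x [y [xy ee]]] := forall_inP simpleE _ eE; exists x, y.
Qed.

Lemma sum_ends (F : T -> R) x y : x != y -> \sum_(v in [set x; y]) F v = F x + F y.
Proof. by move=> xy; rewrite big_setU1 ?inE // big_set1. Qed.

Lemma adjacentE e f v : v \in e -> v \in f -> adjacent e f = (e != f).
Proof.
move=> ve vf; rewrite /adjacent; case: (e == f) => //=.
by apply/pred0Pn; exists v; rewrite /= ve.
Qed.

Lemma matchingP M : reflect
  (M \subset E /\ forall e f v, e \in M -> f \in M -> v \in e -> v \in f -> e = f)
  (matching E M).
Proof.
apply: (iffP andP) => -[ME mM]; split=> //.
  move=> e f v eM fM ve vf; move/forall_inP: mM => /(_ e eM)/forall_inP/(_ f fM).
  by rewrite (adjacentE ve vf) negbK => /eqP.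
apply/forall_inP => e eM; apply/forall_inP => f fM; rewrite /adjacent negb_and !negbK.
case: (boolP [disjoint e & f]); rewrite ?orbT // => /pred0Pn[v /andP[/= ve vf]].
by rewrite (mM e f v eM fM ve vf) eqxx.
Qed.

Lemma matching_eq M e f v : matching E M -> e \in M -> f \in M ->
  v \in e -> v \in f -> e = f.
Proof. by case/matchingP => _; apply. Qed.

Lemma matching_edge M e : matching E M -> e \in M -> e \in E.
Proof. by case/matchingP => /subsetP + _; apply. Qed.

Lemma matching_sub M A : matching E M -> A \subset M -> matching E A.
Proof.
move=> /matchingP[ME mM] AM; apply/matchingP; split; first exact: subset_trans ME.
by move=> e f v /(subsetP AM) eM /(subsetP AM); apply: mM.
Qed.

Lemma matching_trivIset M : matching E M -> trivIset M.
Proof.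
move=> mM; apply/trivIsetP => e f eM fM; apply: contraR => /pred0Pn[v /andP[/= ve vf]].
by rewrite (matching_eq mM eM fM ve vf).
Qed.

Lemma sum_cover M (F : T -> R) : matching E M ->
  \sum_(v in cover M) F v = \sum_(e in M) \sum_(v in e) F v.
Proof. by move=> mM; rewrite (big_trivIset _ (matching_trivIset mM)). Qed.

Lemma coverP M v : reflect (exists2 e, e \in M & v \in e) (v \in cover M).
Proof. by apply: (iffP bigcupP) => -[e]; exists e. Qed.

Lemma cover_in M e v : e \in M -> v \in e -> v \in cover M.
Proof. by move=> eM ve; apply/coverP; exists e. Qed.

Lemma vweightE M e v : matching E M -> e \in M -> v \in e -> vweight M v = w e.
Proof.
move=> mM eM ve; rewrite /vweight (bigD1 e) ?eM //= big1 ?addr0 // => f.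
by case/andP=> /andP[fM vf] /eqP[]; apply: matching_eq mM fM eM vf ve.
Qed.

Lemma vweight0 M v : v \notin cover M -> vweight M v = 0.
Proof.
move=> nv; rewrite /vweight big1 // => e /andP[eM ve].
by rewrite (cover_in eM ve) in nv.
Qed.

Lemma vweight_ge0 M v : M \subset E -> 0 <= vweight M v.
Proof. by move=> ME; apply: sumr_ge0 => e /andP[/(subsetP ME)/w_gt0/ltW]. Qed.

Lemma vweight_gt0 M v : matching E M -> (0 < vweight M v) = (v \in cover M).
Proof.
move=> mM; case: (boolP (v \in cover M)) => [/coverP[e eM ve]|/vweight0->]; last first.
  by rewrite ltxx.
by rewrite (vweightE mM eM ve) w_gt0 // (matching_edge mM eM).
Qed.

Lemma mateE M x y : matching E M -> x != y -> [set x; y] \in M -> mate M x = y.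
Proof.
move=> mM xy xyM; rewrite /mate; case: pickP => [z /andP[zx xzM]|/(_ y)] /=.
  have /setP/(_ z) := matching_eq mM xzM xyM (set21 _ _) (set21 _ _).
  by rewrite !inE eqxx orbT (negbTE zx) /= => /esym/eqP.
by rewrite eq_sym xy xyM.
Qed.

Lemma mateP M v : matching E M -> v \in cover M ->
  mate M v != v /\ [set v; mate M v] \in M.
Proof.
move=> mM /coverP[e eM ve]; have [x xv ee] := edge_endpoint (matching_edge mM eM) ve.
have -> : mate M v = x by apply: mateE; rewrite // -?ee // eq_sym.
by rewrite -ee.
Qed.

Lemma mateK M v : matching E M -> v \in cover M -> mate M (mate M v) = v.
Proof.
move=> mM vM; have [mv vmM] := mateP mM vM.
by apply: mateE => //; rewrite setUC.
Qed.

Section Augmentation.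
Variables (M A : {set {set T}}).
Hypotheses (mM : matching E M) (augA : augmenting E M A).
Local Notation MA := (adjacent_in M A).
Local Notation N := ((M :\: MA) :|: A).

Lemma augmenting_matching : matching E A.
Proof.
case/andP: augA => AE mA; apply/andP; split=> //.
by apply: subset_trans AE (subsetDl _ _).
Qed.

Lemma augmenting_new e : e \in A -> e \notin M.
Proof. by case/andP: augA => /subsetP AE _ /AE; rewrite inE => /andP[]. Qed.

Lemma adjacent_in_sub : MA \subset M.
Proof. by apply/subsetP => e; rewrite inE => /andP[]. Qed.

Lemma adjacent_in_meet e f v : e \in A -> f \in M -> v \in e -> v \in f -> f \in MA.
Proof.
move=> eA fM ve vf; rewrite inE fM; apply/exists_inP; exists e => //.
rewrite (adjacentE ve vf); apply: contraNneq (augmenting_new eA) => ->; exact: fM.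
Qed.

Lemma adjacent_in_ex f : f \in MA -> exists e v, [/\ e \in A, v \in e & v \in f].
Proof.
rewrite inE => /andP[fM /exists_inP[e eA /andP[_ /pred0Pn[v /andP[/= ve vf]]]]].
by exists e, v.
Qed.

Lemma removed_cover v : v \in cover MA -> v \notin cover (M :\: MA).
Proof.
move=> /coverP[f fMA vf]; apply/coverP => -[e]; rewrite inE => /andP[neMA eM] ve.
by rewrite (matching_eq mM eM (subsetP adjacent_in_sub f fMA) ve vf) fMA in neMA.
Qed.

Lemma kept_notin_added e v : e \in M :\: MA -> v \in e -> v \notin cover A.
Proof.
rewrite inE => /andP[neMA eM] ve; apply/coverP => -[a aA va].
by rewrite (adjacent_in_meet aA eM va ve) in neMA.
Qed.

Lemma kept_notin_removed e v : e \in M :\: MA -> v \in e -> v \notin cover MA.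
Proof. by move=> eK ve; apply/negP => /removed_cover; rewrite (cover_in eK ve). Qed.

Lemma added_removed v : v \in cover A -> v \in cover M -> v \in cover MA.
Proof.
move=> /coverP[a aA va] /coverP[f fM vf].
by apply: (cover_in (adjacent_in_meet aA fM va vf)).
Qed.

Lemma augmented_matching : matching E N.
Proof.
apply/matchingP; split.
  rewrite subUset; case/matchingP: mM => ME _; case/matchingP: augmenting_matching => AE _.
  by rewrite AE (subset_trans (subsetDl _ _) ME).
have cross e f v : e \in M :\: MA -> f \in A -> v \in e -> v \in f -> False.
  by move=> eK fA ve vf; have := kept_notin_added eK ve; rewrite (cover_in fA vf).
move=> e f v /setUP[eK|eA] /setUP[fK|fA] ve vf.
- case/setDP: eK => eM _; case/setDP: fK => fM _; exact: matching_eq mM eM fM ve vf.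
- by case: (cross e f v).
- by case: (cross f e v).
- exact: matching_eq augmenting_matching eA fA ve vf.
Qed.

Local Notation p := (vweight M).
Local Notation p' := (vweight N).

Lemma vweight_added e v : e \in A -> v \in e -> p' v = w e.
Proof. by move=> eA; apply: (vweightE augmented_matching); rewrite inE eA orbT. Qed.

Lemma vweight_kept e v : e \in M :\: MA -> v \in e -> p' v = w e.
Proof. by move=> eA; apply: (vweightE augmented_matching); rewrite inE eA. Qed.

Lemma vweight_same v : v \notin cover MA -> v \notin cover A -> p' v = p v.
Proof.
move=> nvMA nvA; case: (boolP (v \in cover M)) => [/coverP[e eM ve]|nvM].
  have eK : e \in M :\: MA by rewrite inE eM andbT; apply: contra nvMA => /cover_in->.
  by rewrite (vweight_kept eK ve) (vweightE mM eM ve).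
rewrite !vweight0 //; apply/coverP => -[e /setUP[/setDP[eM _]|eA] ve].
  by rewrite (cover_in eM ve) in nvM.
by rewrite (cover_in eA ve) in nvA.
Qed.

Lemma vweight_new v : v \notin cover MA -> v \in cover A -> p v = 0.
Proof.
by move=> nvMA vA; apply: vweight0; apply: contra nvMA; apply: added_removed.
Qed.

Lemma vweight_mono v : v \notin cover MA -> p v <= p' v.
Proof.
move=> nv; case: (boolP (v \in cover A)) => vA; last by rewrite vweight_same.
rewrite vweight_new //; apply: vweight_ge0; by case/matchingP: augmented_matching.
Qed.

Lemma weight_augmented : weight w N = weight w M - weight w MA + weight w A.
Proof.
have disj : (M :\: MA) :\: A = M :\: MA.
  apply/setP => e; rewrite !inE; case: (boolP (e \in A)) => // /augmenting_new.
  by move=> /negbTE->; rewrite andbF.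
rewrite /weight [LHS](big_setID A) /= setIC setKU setDUl setDv setU0 disj addrC.
congr (_ + _); rewrite [\sum_(e in M) _](big_setID MA) /=.
rewrite (setIidPr adjacent_in_sub); lra.
Qed.

End Augmentation.

Lemma adjacent_in_mono M A A' : A' \subset A -> adjacent_in M A' \subset adjacent_in M A.
Proof.
move=> sA; apply/subsetP => f; rewrite !inE => /andP[-> /exists_inP[e eA ef]].
by apply/exists_inP; exists e => //; apply: (subsetP sA).
Qed.

Lemma augmenting_sub M A A' : A' \subset A -> augmenting E M A -> augmenting E M A'.
Proof.
move=> sA /andP[AE /forall_inP mA]; rewrite /augmenting (subset_trans sA AE) /=.
apply/forall_inP => e /(subsetP sA)/mA/forall_inP me.
by apply/forall_inP => f /(subsetP sA)/me.
Qed.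

Lemma weight_sub M A : M \subset E -> A \subset M -> weight w A <= weight w M.
Proof.
move=> ME AM; rewrite /weight [leRHS](big_setID A) (setIidPr AM) lerDl.
by apply: sumr_ge0 => e; rewrite inE => /andP[_ /(subsetP ME)/w_gt0/ltW].
Qed.

Lemma weight_union M (F : {set T}) : M \subset E ->
  \sum_(e in M | ~~ [disjoint e & F]) w e <= \sum_(v in F) vweight M v.
Proof.
move=> ME; rewrite /vweight (exchange_big_dep (mem M)) /=; last by move=> v e _ /andP[].
rewrite big_mkcondr /=; apply: ler_sum => e eM.
have w0 : 0 <= w e by apply/ltW/w_gt0/(subsetP ME).
case: (boolP [disjoint e & F]) => [_|/pred0Pn[v /andP[/= ve vF]]]; first exact: sumr_ge0.
by rewrite (bigD1 v) ?vF ?eM //= lerDl sumr_ge0.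
Qed.

End Matchings.

(** * Exchange arguments from the optimality of the augmenting set *)

Section Gain.
Variables (R : realFieldType) (T : finType) (E : {set {set T}}) (w : {set T} -> R).
Hypothesis simpleE : simple_graph E.
Hypothesis w_gt0 : forall e, e \in E -> 0 < w e.
Variables (k : R) (M A : {set {set T}}).
Hypotheses (k_gt0 : 0 < k) (mM : matching E M) (augA : augmenting E M A).
Local Notation MA := (adjacent_in M A).
Local Notation N := ((M :\: MA) :|: A).
Implicit Types (e f : {set T}) (F Q : {set {set T}}).

Let subE F : F \subset M -> F \subset E.
Proof. by move/subset_trans; apply; case/matchingP: mM. Qed.

Lemma weight_setU F Q : F :|: Q \subset E -> weight w (F :|: Q) <= weight w F + weight w Q.
Proof.
move=> FQE; rewrite /weight (big_setID F) /= setUK lerD2l.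
rewrite setDUl setDv set0U; apply: (weight_sub w_gt0) (subsetDl _ _).
by apply: subset_trans FQE; apply: subsetUr.
Qed.

(* Deleting from A the edges that meet f keeps f in M. *)
Lemma removed_edge_cover f :
  (forall A' : {set {set T}}, A' \subset A -> gain w k M A' <= gain w k M A) ->
  f \in MA -> k * w f <= \sum_(v in f) vweight w N v.
Proof.
move=> optA fMA; set A1 := [set a in A | [disjoint a & f]].
have sA1 : A1 \subset A by apply/subsetP => a; rewrite inE => /andP[].
have mA := augmenting_matching augA; have [AE _] := matchingP _ _ mA.
have MAE : MA \subset E by apply/subE/adjacent_in_sub.
have h1 : weight w A = weight w A1 + \sum_(a in A | ~~ [disjoint a & f]) w a.
  rewrite /weight (bigID (fun a : {set T} => [disjoint a & f])) /=; congr (_ + _).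
  by apply: eq_bigl => a; rewrite inE.
have h2 : \sum_(a in A | ~~ [disjoint a & f]) w a <= \sum_(v in f) vweight w N v.
  apply: le_trans (weight_union w_gt0 f AE) _; apply: ler_sum => v _.
  rewrite /vweight [leRHS](bigID (mem A)) /=.
  rewrite (eq_bigl (fun e => ((e \in N) && (v \in e)) && (e \in A))); last first.
    by move=> e; rewrite inE; case: (e \in A); rewrite ?orbT ?andbF ?andbT.
  rewrite lerDl; apply: sumr_ge0 => e /andP[/andP[eN _] _]; apply/ltW/w_gt0.
  exact: matching_edge (augmented_matching mM augA) eN.
have h3 : weight w (adjacent_in M A1) + w f <= weight w MA.
  have -> : weight w MA = weight w (MA :\ f) + w f.
    by rewrite /weight (big_setD1 f) //= addrC.
  rewrite lerD2r.
  apply: (weight_sub w_gt0) => //; first by apply: subset_trans (subsetDl _ _) MAE.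
  apply/subsetP => e eM1; rewrite in_setD1 (subsetP (adjacent_in_mono _ sA1) _ eM1) andbT.
  apply: contraTneq eM1 => ->; apply/negP => /(adjacent_in_ex)[a [v []]].
  rewrite inE => /andP[_ /pred0P/(_ v) /= + va vf]; by rewrite va vf.
have := optA _ sA1; rewrite /gain h1.
have : k * (weight w (adjacent_in M A1) + w f) <= k * weight w MA by rewrite ler_pM2l.
lra.
Qed.

(* Compare A with Q together with the edges of A that do not meet Q. *)
Lemma unprofitable Q : 1 <= k -> augmenting E M Q ->
  (forall A' : {set {set T}}, A' \subset Q :|: A -> augmenting E M A' -> gain w k M A' <= gain w k M A) ->
  weight w Q <= k * \sum_(e in N | ~~ [disjoint e & cover Q]) w e.
Proof.
move=> k1 augQ optA; set AQ := [set a in A | [disjoint a & cover Q]].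
have sAQ : AQ \subset A by apply/subsetP => a; rewrite inE => /andP[].
have mA := augmenting_matching augA; have [AE _] := matchingP _ _ mA.
have mQ := augmenting_matching augQ; have [QE _] := matchingP _ _ mQ.
have mAQ := matching_sub mA sAQ; have [AQE _] := matchingP _ _ mAQ.
have MAE : MA \subset E by apply/subE/adjacent_in_sub.
have cross e f v : e \in Q -> f \in AQ -> v \in e -> v \in f -> False.
  move=> eQ; rewrite inE => /andP[_ /pred0P/(_ v) /= fQ] ve vf.
  by rewrite vf (cover_in eQ ve) in fQ.
have augU : augmenting E M (Q :|: AQ).
  have mU : matching E (Q :|: AQ).
    apply/matchingP; split; first by rewrite subUset QE.
    move=> e f v /setUP[eQ|eA] /setUP[fQ|fA] ve vf.
    - exact: matching_eq mQ eQ fQ ve vf.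
    - by case: (cross e f v).
    - by case: (cross f e v).
    - exact: matching_eq mAQ eA fA ve vf.
  rewrite /augmenting; case/andP: mU => _ ->; rewrite andbT subUset.
  by case/andP: augQ => -> _; case/andP: augA => AEM _; rewrite (subset_trans sAQ AEM).
have := optA _ (setUS _ sAQ) augU; rewrite /gain.
have disj : [disjoint Q & AQ].
  apply/pred0P => e /=; apply/negP => /andP[eQ eA].
  have [x [y [_ ee]]] := edge_ends simpleE (subsetP QE _ eQ).
  by apply: (cross e e x) => //; rewrite ee !inE eqxx.
have -> : weight w (Q :|: AQ) = weight w Q + weight w AQ.
  rewrite /weight (big_setID Q) /= setUK; congr (_ + _).
  rewrite setDUl setDv set0U; apply: eq_bigl => e; rewrite in_setD; case: (boolP (e \in Q)) => //= eQ.
  by have /pred0P/(_ e) /= := disj; rewrite eQ /= => ->.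
pose Kp := [set e in M :\: MA | ~~ [disjoint e & cover Q]].
have KpM : Kp \subset M by apply/subsetP => e; rewrite !inE => /andP[/andP[]].
have h1 : weight w (adjacent_in M (Q :|: AQ)) <= weight w MA + weight w Kp.
  have UE : MA :|: Kp \subset E by rewrite subUset MAE subE.
  apply: le_trans (weight_setU UE).
  apply: (weight_sub w_gt0) => //; apply/subsetP => e eMU; rewrite inE.
  case: (boolP (e \in MA)) => //= neMA.
  have [a [v [aU va ve]]] := adjacent_in_ex eMU.
  have eM := subsetP (adjacent_in_sub _ _) _ eMU.
  rewrite [_ \in Kp]inE in_setD neMA eM /=; case/setUP: aU => [aQ|aAQ].
    by apply/pred0Pn; exists v; rewrite /= ve (cover_in aQ va).
  case/negP: neMA; apply: (adjacent_in_meet augA _ eM va ve); exact: (subsetP sAQ).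
have h2 : weight w A = weight w AQ + \sum_(a in A | ~~ [disjoint a & cover Q]) w a.
  rewrite /weight (bigID (fun a : {set T} => [disjoint a & cover Q])) /=; congr (_ + _).
  by apply: eq_bigl => a; rewrite inE.
have -> : \sum_(e in N | ~~ [disjoint e & cover Q]) w e
   = weight w Kp + \sum_(a in A | ~~ [disjoint a & cover Q]) w a.
  rewrite (bigID (mem A)) /= addrC; congr (_ + _); apply: eq_bigl => e.
    rewrite [RHS]inE in_setU !in_setD.
    case: (boolP (e \in A)) => [eA|_]; last by rewrite orbF andbT.
    by rewrite andbF (negbTE (augmenting_new augA eA)) andbF.
  by rewrite inE; case: (e \in A); rewrite ?orbT ?andbT ?andbF.
set s := \sum_(a in A | _) w a in h2 *.
have s0 : 0 <= s by apply: sumr_ge0 => a /andP[aA _]; apply/ltW/w_gt0/(subsetP AE).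
have : k * weight w (adjacent_in M (Q :|: AQ)) <= k * (weight w MA + weight w Kp).
  by rewrite ler_pM2l.
(* The exchange loses the edges of [A] that meet [Q] only at factor 1. Since [k >= 1] they may be
   counted like the kept edges of [M]. *)
have : s <= k * s by rewrite ler_peMl.
lra.
Qed.

End Gain.

(** * The ledger of charges and its update by an augmentation *)

(* A vertex with charge [k * U] has the levels from 0 to [U], of which an edge of
   weight [q] covering it bears those from 0 to [q].
   For an end [x] of an edge of M whose shadow edge at [x] is
   [[set x; target x]], [reserve x] is the weight of that shadow edge (or 0 if it
   is not used), and the interval from [lo x] to [hi x] holds the levels of
   [target x] that were paid for when the shadow edge left M and that have not
   been borne by M since. *)
Record ledger (R : realFieldType) (T : finType) := Ledger {
  charge : T -> R;
  reserve : T -> R;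
  lo : T -> R;
  hi : T -> R;
  target : T -> T;
  extra : {set T} -> R }.

(** The part of the reserve that is already financed: each unit is backed by [k - 1] in [bal_total].
    A level of the interval that M bears again moves into the bank. *)
Definition banked (R : realFieldType) (T : finType) (L : ledger R T) x : R :=
  reserve L x - (hi L x - lo L x).

Section Ledger.
Variables (R : realFieldType) (T : finType) (E : {set {set T}}) (w : {set T} -> R).
Variables (k d : R).
Local Notation vweight := (vweight w).

(** This is what the shadow edge at [x] and the charge at [y] contribute to the saving of the edge
    [xy]. While [y] awaits its optimal edge the contribution is a promise, [d * k] being [1 - 1/k].
    Once [y] is in [S], it has to be present as slack at [y] or as money in the bank of [x]. *)
Definition credit (S : {set T}) M (L : ledger R T) x y : R :=
  if y \in S then Num.max 0 (k * vweight M y - charge L y) + (k - 1) * banked L x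
  else d * k * reserve L x.

(** [S] stands for the ends of the optimal edges read so far. [bal_total] is the potential
    inequality, and [bal_edge] secures the saving [d] per unit of weight for every edge of M.
    [bal_stack] states disjointness through lengths in arbitrary windows, a form that can be summed
    directly. *)
Record balanced (S : {set T}) (M : {set {set T}}) (L : ledger R T) : Prop := Balanced {
  bal_charge : forall v, 0 <= charge L v;
  bal_reserve : forall x, 0 <= reserve L x;
  bal_lo : forall x, 0 <= lo L x;
  bal_gap : forall x, lo L x <= hi L x;
  bal_hi : forall x,
    hi L x <= Num.max (lo L x) (Num.min (reserve L x) (charge L (target L x) / k));
  bal_extra : forall e, 0 <= extra L e;
  bal_owner : forall x, 0 < reserve L x ->
    [/\ x \in cover M, target L x != x, vweight M (target L x) <= lo L x
      & reserve L x <= vweight M x + banked L x];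
  bal_meet : forall x y, 0 < reserve L x -> 0 < reserve L y -> x != y ->
    ~~ [disjoint [set x; target L x] & [set y; target L y]] ->
    Num.min (reserve L x) (reserve L y) <= banked L x
    \/ Num.min (reserve L x) (reserve L y) <= banked L y;
  (* The intervals with the same target are disjoint, and they lie between the
     weight that covers the target and the height of its charge. *)
  bal_stack : forall a q r, vweight M a <= q -> q <= r ->
    \sum_(x | target L x == a) (clip q r (hi L x) - clip q r (lo L x))
      <= clip q r (charge L a / k) - q;
  bal_total : \sum_v Num.max 0 (charge L v - k * vweight M v)
      + \sum_(e in M) extra L e + (k - 1) * \sum_v banked L v
      <= k / (k - 1) * weight w M;
  bal_edge : forall x y, x != y -> [set x; y] \in M ->
    d * w [set x; y] <= extra L [set x; y] + credit S M L x y + credit S M L y x }.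

Hypothesis simpleE : simple_graph E.
Hypothesis w_gt0 : forall e, e \in E -> 0 < w e.
Hypothesis kd : rate k d.

Lemma gap_bound S M L : balanced S M L ->
  forall x, hi L x - lo L x <= Num.max 0 (reserve L x - lo L x).
Proof.
move=> bL x; have h := bal_hi bL x; have h0 := bal_lo bL x; have r0 := bal_reserve bL x.
have mr : Num.min (reserve L x) (charge L (target L x) / k) <= reserve L x.
  by rewrite ge_min lexx.
by move: mr h; set m := Num.min _ _; minmax.
Qed.

Lemma banked_bounds S M L : balanced S M L -> forall x, 0 <= banked L x <= reserve L x.
Proof.
move=> bL x; have := gap_bound bL x; have h0 := bal_lo bL x; have r0 := bal_reserve bL x.
have g := bal_gap bL x; rewrite /banked; minmax.
Qed.

(** * The ledger after an augmentation *)

Section Settle.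
Variables (M A : {set {set T}}) (L : ledger R T) (S : {set T}).
Hypotheses (mM : matching E M) (augA : augmenting E M A) (bL : balanced S M L).
Hypothesis optA :
  forall A' : {set {set T}}, A' \subset A -> gain w k M A' <= gain w k M A.
Local Notation MA := (adjacent_in M A).
Local Notation N := ((M :\: MA) :|: A).
Local Notation p := (vweight M).
Local Notation p' := (vweight N).
Local Notation mu := (mate M).
Local Notation u v := (charge L v / k).

Definition heavy_end v : bool := heavy (p v) (p' (mu v)) (p' v).

(* A removed edge with both ends covered anew serves only one of the new edges. *)
Definition settled_reserve x : R :=
  if x \in cover MA then (if heavy_end x then p x else 0) else reserve L x.

(** If neither end of [e] is in [S], the promises of its shadow edges are worth [d * k] times their
    reserves, and this is the amount missing to [d * w e]. An edge with an end that lost weight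
    needs nothing, since its bonus there is already [d * w e]. *)
Definition topup (e : {set T}) : R :=
  if [forall v in e, p v <= p' v]
  then d * Num.max 0 (w e - k * \sum_(v in e) settled_reserve v) else 0.

(** Charges stay. A removed edge that is heavy at [x] opens an interval at [mu x], from the new
    weight there up to its own weight or the charge, whichever is lower. For a kept owner, both
    interval ends are raised to the new weight of the target, which cuts off the levels borne again.
    Each of these is worth [k]: [k - 1] goes to the bank of the owner and 1 to [extra] of the new
    edge at the target. *)
Definition settled : ledger R T := Ledger
  (charge L) settled_reserve
  (fun x => if x \in cover MA then p' (mu x) else Num.max (lo L x) (p' (target L x)))
  (fun x => if x \in cover MA then
     (if heavy_end x then Num.max (p' (mu x)) (Num.min (p x) (u (mu x))) else p' (mu x))
     else Num.max (hi L x) (p' (target L x)))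
  (fun x => if x \in cover MA then mu x else target L x)
  (fun e : {set T} => if e \in A then
     \sum_(v in e) (released (p' v) (p v) (u v) + bonus d (p v) (p' (mu v)) (p' v))
       + topup e
     else extra L e).

Let k1 : 1 < k. Proof. by case: kd. Qed.
Let k0 : 0 < k. Proof. exact: lt_trans ltr01 k1. Qed.
Let mN : matching E N. Proof. exact: augmented_matching. Qed.
Let p_ge0 v : 0 <= p v.
Proof. by apply: (vweight_ge0 w_gt0); case/matchingP: mM. Qed.
Let p'_ge0 v : 0 <= p' v.
Proof. by apply: (vweight_ge0 w_gt0); case/matchingP: mN. Qed.
Let u_ge0 v : 0 <= u v.
Proof. by rewrite divr_ge0 ?(bal_charge bL) // ltW. Qed.
Let mMA : matching E MA. Proof. exact: matching_sub mM (adjacent_in_sub _ _). Qed.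
Let mA : matching E A. Proof. exact: augmenting_matching augA. Qed.

Lemma removed_pair x : x \in cover MA ->
  [/\ mu x != x, [set x; mu x] \in MA, mu x \in cover MA, mu (mu x) = x
    & p (mu x) = p x] /\ 0 < p x /\ k * p x <= p' x + p' (mu x) /\ w [set x; mu x] = p x.
Proof.
move=> xMA; have [f fMA xf] := coverP _ _ xMA.
have fM : f \in M := subsetP (adjacent_in_sub _ _) _ fMA.
have xM := cover_in fM xf; have [mx mxM] := mateP simpleE mM xM.
have ef : [set x; mu x] = f by apply: (matching_eq mM mxM fM (set21 _ _) xf).
have px : p x = w [set x; mu x] by apply: (vweightE _ mM mxM); rewrite set21.
have pm : p (mu x) = w [set x; mu x] by apply: (vweightE _ mM mxM); rewrite set22.
split; first split=> //.
- by rewrite ef.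
- by apply: (cover_in fMA); rewrite -ef set22.
- exact: (mateK simpleE mM xM).
- by rewrite pm px.
split; first by rewrite (vweight_gt0 w_gt0 _ mM).
split=> //; rewrite px.
rewrite -(sum_ends _ (x := x) (y := mu x)) 1?eq_sym //.
by apply: (removed_edge_cover w_gt0 k0 mM augA optA); rewrite ef.
Qed.

Lemma reserve_zero x : reserve L x = 0 -> hi L x = lo L x.
Proof.
by move=> r0; have := gap_bound bL x; have := bal_gap bL x; have := bal_lo bL x;
  rewrite r0; minmax.
Qed.

Lemma owner_kept x : x \notin cover MA -> 0 < reserve L x ->
  exists2 e, e \in M :\: MA & x \in e.
Proof.
move=> nxMA /(bal_owner bL)[/coverP[e eM xe] _ _ _]; exists e => //.
by rewrite in_setD eM andbT; apply: contra nxMA => /cover_in->.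
Qed.

Lemma settled_gap x : x \notin cover MA ->
  (hi L x - lo L x) - (hi settled x - lo settled x)
  = clip (p (target L x)) (Num.max (p (target L x)) (p' (target L x))) (hi L x)
    - clip (p (target L x)) (Num.max (p (target L x)) (p' (target L x))) (lo L x).
Proof.
move=> nx; rewrite /= (negbTE nx).
have := bal_reserve bL x; rewrite le_eqVlt => /orP[/eqP/esym r0|r0].
  by rewrite (reserve_zero r0) !subrr.
by have [_ _ pl _] := bal_owner bL r0; rewrite clip_raise // (bal_gap bL).
Qed.

Lemma settled_banked x : x \notin cover MA -> banked L x <= banked settled x.
Proof.
move=> nx; rewrite /banked; have := settled_gap nx.
have -> : reserve settled x = reserve L x by rewrite /= /settled_reserve (negbTE nx).
have := @clip_mono R (p (target L x)) (Num.max (p (target L x)) (p' (target L x))) _ _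
          (bal_gap bL x).
lra.
Qed.

Lemma settled_banked_new x : x \in cover MA ->
  banked settled x = secured (p x) (p' (mu x)) (p' x) (u (mu x)).
Proof.
move=> xMA; rewrite /banked /= /settled_reserve xMA /secured /heavy_end.
by case: ifP => // _; rewrite subrr subr0.
Qed.

Lemma heavy_facts x : x \in cover MA -> heavy_end x ->
  [/\ p' (mu x) < p x, p x <= p' x & x \in cover A].
Proof.
move=> xMA /andP[h1 h2]; split=> //.
have [_ [px _]] := removed_pair xMA.
have : x \in cover N by rewrite -(vweight_gt0 w_gt0 _ mN) (lt_le_trans px).
case/coverP => e /setUP[eK xe|eA xe]; last exact: cover_in eA xe.
by have := kept_notin_removed mM eK xe; rewrite xMA.
Qed.

Lemma settled_gap_new x : x \in cover MA -> heavy_end x ->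
  hi settled x - lo settled x = released (p x) (p' (mu x)) (u (mu x)).
Proof.
move=> xMA hx; have [h1 h2 _] := heavy_facts xMA hx.
have u0 := u_ge0 (mu x).
rewrite /= xMA hx /released; move: h1; set a := p' _; set f := p _; set U := _ / k => h1.
by minmax.
Qed.

Lemma settled_owner x : 0 < reserve settled x ->
  [/\ x \in cover N, target settled x != x, p' (target settled x) <= lo settled x
    & reserve settled x <= p' x + banked settled x].
Proof.
case: (boolP (x \in cover MA)) => [xMA|nxMA].
  have [[mx _ _ _ _] [px [kp _]]] := removed_pair xMA.
  rewrite /= /settled_reserve xMA; case: (boolP (heavy_end x)) => [hx _|]; last by rewrite ltxx.
  have [h1 h2 xA] := heavy_facts xMA hx.
  split=> //.
    have /coverP[e eA xe] := xA; apply: (cover_in _ xe).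
    by rewrite inE eA orbT.
  have := settled_gap_new xMA hx; rewrite /banked.
  have := released_le (u (mu x)) (ltW h1).
  have -> : reserve settled x = p x by rewrite /= /settled_reserve xMA hx.
  have : p x <= k * p x by rewrite ler_peMl // ltW.
  lra.
have ->: reserve settled x = reserve L x by rewrite /= /settled_reserve (negbTE nxMA).
move=> rx; have [xM tx pl rp] := bal_owner bL rx.
have [e eK xe] := owner_kept nxMA rx.
have nxA := kept_notin_added augA eK xe.
rewrite (vweight_same _ mM augA nxMA nxA); split.
- by apply: (cover_in _ xe); rewrite inE eK.
- by rewrite /= (negbTE nxMA).
- by rewrite /= (negbTE nxMA) le_max lexx orbT.
- by have := settled_banked nxMA; lra.
Qed.

Lemma settled_hi x : hi settled x
  <= Num.max (lo settled x) (Num.min (reserve settled x) (charge L (target settled x) / k)).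
Proof.
rewrite /= /settled_reserve; case: ifP => [xMA|_].
  case: ifP => [hx|_]; last by rewrite le_max lexx.
  by rewrite ge_max le_max lexx /= le_max lexx orbT.
have := bal_hi bL x; set m := Num.min _ _ => h.
by move: h; set t := p' _; minmax.
Qed.

(** An old shadow edge can meet a new one only at its own target, which lies on a removed edge. The
    weight of that edge, the reserve of the new shadow edge, is thus at most [lo], and the bank
    holds at least the smaller of [lo] and the old reserve. Two new ones that meet would come from
    one removed edge that is heavy at both ends, which is impossible. *)
Lemma settled_meet x y : 0 < reserve settled x -> 0 < reserve settled y -> x != y ->
  ~~ [disjoint [set x; target settled x] & [set y; target settled y]] ->
  Num.min (reserve settled x) (reserve settled y) <= banked settled x
  \/ Num.min (reserve settled x) (reserve settled y) <= banked settled y.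
Proof.
have mixed a b : a \notin cover MA -> b \in cover MA ->
    0 < reserve settled a -> 0 < reserve settled b ->
    ~~ [disjoint [set a; target settled a] & [set b; target settled b]] ->
    Num.min (reserve settled a) (reserve settled b) <= banked settled a.
  move=> na bMA; have [[mb bM mbMA mmb pmb] [pb _]] := removed_pair bMA.
  have -> : reserve settled a = reserve L a by rewrite /= /settled_reserve (negbTE na).
  have -> : reserve settled b = if heavy_end b then p b else 0.
    by rewrite /= /settled_reserve bMA.
  have -> : target settled a = target L a by rewrite /= (negbTE na).
  have -> : target settled b = mu b by rewrite /= bMA.
  case: ifP => [hb ra _|]; last by rewrite ltxx.
  have [e eK ae] := owner_kept na ra; have [_ _ pl _] := bal_owner bL ra.
  have nab : a \notin [set b; mu b].
    by apply: contra (kept_notin_removed mM eK ae) => /(cover_in bM).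
  move=> /pred0Pn[v /= /andP[va vb]].
  have ptb : p (target L a) = p b.
    move: va vb; rewrite inE => /orP[/set1P->|/set1P->]; first by rewrite (negbTE nab).
    by rewrite !inE => /orP[]/eqP->.
  have := settled_banked na; have := gap_bound bL a; rewrite /banked.
  have := bal_gap bL a; have := bal_reserve bL a; rewrite -ptb.
  by move: pl; minmax.
case: (boolP (x \in cover MA)) => xMA; case: (boolP (y \in cover MA)) => yMA rx ry xy meet.
- exfalso; move: rx ry meet; rewrite /= /settled_reserve xMA yMA.
  case: ifP => [hx _|]; last by rewrite ltxx.
  case: ifP => [hy _|]; last by rewrite ltxx.
  have [[mx xM _ _ pmx] _] := removed_pair xMA; have [[my yM _ _ _] _] := removed_pair yMA.
  move=> /pred0Pn[v /andP[/= vx vy]].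
  have exy := matching_eq mMA xM yM vx vy.
  have ymx : mu x = y.
    have : y \in [set x; mu x] by rewrite exy set21.
    by rewrite !inE eq_sym (negbTE xy) /= => /eqP.
  have [h1 h2 _] := heavy_facts xMA hx; have [h3 h4 _] := heavy_facts yMA hy.
  by move: h1 h4; rewrite ymx -ymx pmx => h1 h4; have := lt_le_trans h1 h4; rewrite ltxx.
- by right; rewrite minC; apply: mixed => //; rewrite disjoint_sym.
- by left; apply: mixed.
- move: rx ry meet.
  rewrite /= /settled_reserve (negbTE xMA) (negbTE yMA) => rx ry meet.
  have := settled_banked xMA; have := settled_banked yMA.
  by have [h|h] := bal_meet bL rx ry xy meet => byy bxx; [left|right]; apply: le_trans h _.
Qed.

(** The only owner of a new interval at [a] is [mu a]. Its interval ends at or below the old weight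
    [p a], whereas all older ones start at [p a] or above. *)
Lemma settled_stack a q r : p' a <= q -> q <= r ->
  \sum_(x | target settled x == a) (clip q r (hi settled x) - clip q r (lo settled x))
    <= clip q r (u a) - q.
Proof.
move=> paq qr; rewrite (bigID (mem (cover MA))) /=.
rewrite [X in _ + X](_ : _ = \sum_(x | (target L x == a) && (x \notin cover MA))
    (clip q r (hi L x) - clip q r (lo L x))); last first.
  apply: eq_big => [x|x /andP[+ nx]]; first by case: (x \in cover MA); rewrite ?andbF.
  by rewrite (negbTE nx) => /eqP xa; rewrite !clip_max // xa.
have old_le q' r' : p a <= q' -> q' <= r' ->
    \sum_(x | (target L x == a) && (x \notin cover MA))
      (clip q' r' (hi L x) - clip q' r' (lo L x)) <= clip q' r' (u a) - q'.
  move=> pq qr'; apply: le_trans (bal_stack bL pq qr').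
  rewrite [leRHS](bigID (mem (cover MA))) /= addrC lerDl.
  by apply: sumr_ge0 => x _; rewrite subr_ge0 clip_mono // (bal_gap bL).
case: (boolP (a \in cover MA)) => [aMA|naMA]; last first.
  rewrite big1 ?add0r.
    by apply: old_le => //; apply: le_trans paq; apply: (vweight_mono w_gt0 mM augA naMA).
  move=> x /andP[+ xMA]; rewrite xMA => /eqP xa.
  by have [[_ _ mx _ _] _] := removed_pair xMA; rewrite -xa mx in naMA.
have [[ma aM mbMA mma pma] _] := removed_pair aMA.
have [[mb bM _ _ pmb] _] := removed_pair mbMA.
rewrite (big_pred1 (mu a)); last first.
  move=> x /=; apply/andP/eqP => [[+ xMA]|->].
    by rewrite xMA => /eqP <-; have [[_ _ _ -> _] _] := removed_pair xMA.
  by rewrite mbMA mma eqxx.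
rewrite mbMA mma pma /heavy_end mma pma /heavy.
(* If the weight at [a] has not dropped, [mu a] is not a heavy end and its interval is empty. *)
case: (leP (p a) (p' a)) => pa /=.
  by rewrite subrr add0r; apply: old_le; lra.
have stacked : \sum_(x | (target L x == a) && (x \notin cover MA))
      (clip q r (hi L x) - clip q r (lo L x))
    <= clip (Num.max q (p a)) (Num.max r (p a)) (u a) - Num.max q (p a).
  have pq : p a <= Num.max q (p a) by rewrite le_max lexx orbT.
  have qr' : Num.max q (p a) <= Num.max r (p a) by rewrite ge_max !le_max qr lexx orbT.
  apply: le_trans (old_le _ _ pq qr'); apply: ler_sum => x /andP[/eqP xa nx].
  have := bal_reserve bL x; rewrite le_eqVlt => /orP[/eqP/esym r0|r0].
    by rewrite (reserve_zero r0) !subrr.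
  have [_ _ pl _] := bal_owner bL r0; rewrite xa in pl.
  by rewrite clip_diff_above // (le_trans pl) // (bal_gap bL).
have := clip_stack (u a) paq qr pa.
case: ifP => [hb|_]; last first.
  have : clip q r (p' a) <= clip q r (Num.max (p' a) (Num.min (p a) (u a))).
    by apply: clip_mono; rewrite le_max lexx.
  lra.
lra.
Qed.

Local Notation rho v := (released (p' v) (p v) (u v)).

Let rho_ge0 v : 0 <= rho v.
Proof. by rewrite /released le_max lexx. Qed.

Let kd0 : 0 < d. Proof. exact: rate_gt0 kd. Qed.

(** An interval at [a] shrinks only by levels between [p a] and [p' a]. By [bal_stack] the intervals
    there are disjoint and below the charge, so all their owners together bank at most [rho a]. *)
Lemma settled_banked_total : \sum_v banked settled v
  <= \sum_v banked L v + \sum_v rho v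
     + \sum_(v in cover MA) secured (p v) (p' (mu v)) (p' v) (u (mu v)).
Proof.
rewrite (bigID (mem (cover MA))) /= addrC.
rewrite (eq_bigr _ (fun v vMA => settled_banked_new vMA)) lerD2r.
apply: le_trans (_ : \sum_(v | v \notin cover MA) (banked L v +
  ((hi L v - lo L v) - (hi settled v - lo settled v))) <= _).
  apply: ler_sum => v nv; rewrite /banked.
  have -> : reserve settled v = reserve L v by rewrite /= /settled_reserve (negbTE nv).
  lra.
rewrite big_split /=; apply: lerD.
  rewrite [leRHS](bigID (mem (cover MA))) /= lerDr sumr_ge0 // => v _.
  by case/andP: (banked_bounds bL v).
pose c v x := clip (p v) (Num.max (p v) (p' v)) x.
apply: le_trans (_ : \sum_v (c (target L v) (hi L v) - c (target L v) (lo L v)) <= _).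
  rewrite [leRHS](bigID (mem (cover MA))) /= addrC -[leLHS]addr0; apply: lerD.
    by apply: ler_sum => v nv; have := settled_gap nv; rewrite /= (negbTE nv) => ->.
  by apply: sumr_ge0 => v _; rewrite subr_ge0 clip_mono // (bal_gap bL).
rewrite (partition_big (target L) predT) //=; apply: ler_sum => a _.
apply: le_trans (_ : clip (p a) (Num.max (p a) (p' a)) (u a) - p a <= _).
  have mx : p a <= Num.max (p a) (p' a) by rewrite le_max lexx.
  apply: le_trans (bal_stack bL (lexx _) mx).
  by apply: ler_sum => v /eqP->.
by rewrite clip_rest.
Qed.

Lemma added_reserve v : v \in cover A ->
  settled_reserve v = if (v \in cover MA) && heavy_end v then p v else 0.
Proof.
rewrite /settled_reserve => vA; case: (boolP (v \in cover MA)) => //= nvMA.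
apply/eqP; have := bal_reserve bL v; rewrite le_eqVlt => /orP[/eqP<-//|].
by case/(owner_kept nvMA) => e eK ve; have := kept_notin_added augA eK ve; rewrite vA.
Qed.

Lemma settled_reserve_ge0 v : 0 <= settled_reserve v.
Proof.
rewrite /settled_reserve; case: ifP => _; last exact: (bal_reserve bL).
by case: ifP.
Qed.

Definition swap_free (f : {set T}) : bool := [forall v in f, p v <= p' v].

Lemma topup_ge0 e : 0 <= topup e.
Proof.
by rewrite /topup; case: ifP => // _; rewrite mulr_ge0 ?le_max ?lexx // ltW.
Qed.

(* The added edges that need a top-up form a subset of A, whose gain is at most
   that of A. *)
Lemma topup_total : 0 <= gain w k M A ->
  \sum_(e in A) topup e <= k / (k - 1) * gain w k M A
    + \sum_(f in MA) (if swap_free f then (k - 2 * d) * w f else 0).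
Proof.
move=> g0; have kk := k1; have kk0 := k0; have dd0 := kd0.
have [d1 [d2 [d3 [d4 d5]]]] := rate_bounds kd.
pose O := [set e in A | swap_free e && (0 < w e - k * \sum_(v in e) settled_reserve v)].
have OA : O \subset A by apply/subsetP => e; rewrite inE => /andP[].
have mO := matching_sub mA OA.
have -> : \sum_(e in A) topup e
   = d * (weight w O - k * \sum_(e in O) \sum_(v in e) settled_reserve v).
  rewrite /weight mulr_sumr -sumrB mulr_sumr big_mkcond [RHS]big_mkcond /=.
  apply: eq_bigr => e _; rewrite inE /topup -/(swap_free e).
  case: (e \in A) => //=; case: (swap_free e) => //=.
  by case: ltP => //; rewrite mulr0.
have := optA OA; set g := gain w k M A; rewrite /gain => gO.
pose F := \sum_(f in MA | swap_free f) w f.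
have F0 : 0 <= F.
  by apply: sumr_ge0 => f /andP[fMA _]; apply/ltW/w_gt0/(matching_edge mMA fMA).
have -> : \sum_(f in MA) (if swap_free f then (k - 2 * d) * w f else 0) = (k - 2 * d) * F.
  by rewrite /F mulr_sumr [RHS]big_mkcondr.
have MOA := adjacent_in_mono M OA.
have mMO := matching_sub mMA MOA.
(* A removed edge that meets [O] is either swap-free and counted in [F], or it is heavy at its end
   in [O], so that its weight is the reserve of that end. *)
have hO : weight w (adjacent_in M O)
    <= F + \sum_(e in O) \sum_(v in e) settled_reserve v.
  rewrite /weight (bigID swap_free) /=; apply: lerD.
    rewrite /F [leRHS](bigID (mem (adjacent_in M O))) /=.
    rewrite (eq_bigl (fun f => ((f \in MA) && swap_free f) && (f \in adjacent_in M O))).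
      rewrite lerDl; apply: sumr_ge0 => f /andP[/andP[fMA _] _].
      exact/ltW/w_gt0/(matching_edge mMA fMA).
    move=> f; case: (boolP (f \in adjacent_in M O)) => [fO|]; last by rewrite andbF.
    by rewrite (subsetP MOA _ fO) andbT.
  rewrite -(sum_cover _ mO).
  apply: le_trans (_ : \sum_(f in adjacent_in M O) \sum_(v in f)
     (if v \in cover O then settled_reserve v else 0) <= _).
    rewrite [leLHS]big_mkcondr /=; apply: ler_sum => f fO.
    have term0 v : 0 <= (if v \in cover O then settled_reserve v else 0).
      by case: ifP => // _; apply: settled_reserve_ge0.
    case: ifP => [nsf|_]; last exact: sumr_ge0.
    have [e [v [eO ve vf]]] := adjacent_in_ex fO.
    have fMA := subsetP MOA _ fO; have vMA := cover_in fMA vf.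
    have eA := subsetP OA _ eO.
    rewrite (bigD1 v) //= (cover_in eO ve) (added_reserve (cover_in eA ve)) vMA /=.
    have sfe : swap_free e by move: eO; rewrite inE => /andP[_ /andP[]].
    have pv := forall_inP sfe _ ve.
    have [[mv vmMA mvMA mmv pmv] [_ [_ wp]]] := removed_pair vMA.
    have ef : [set v; mu v] = f := matching_eq mMA vmMA fMA (set21 _ _) vf.
    have -> : heavy_end v.
      rewrite /heavy_end /heavy pv andbT ltNge; apply: contra nsf => pmu.
      apply/forall_inP => x; rewrite -ef !inE => /orP[]/eqP-> //.
      by rewrite pmv.
    by rewrite -ef wp lerDl sumr_ge0.
  rewrite -(sum_cover _ mMO) -big_mkcondr /= [leRHS](bigID (mem (cover (adjacent_in M O)))) /=.
  rewrite (eq_bigl (fun v => (v \in cover O) && (v \in cover (adjacent_in M O)))).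
    by rewrite lerDl; apply: sumr_ge0 => v _; apply: settled_reserve_ge0.
  by move=> v; rewrite andbC.
set B := \sum_(e in O) _ in hO *.
have h1 : weight w O - k * B <= g + k * F.
  have : k * weight w (adjacent_in M O) <= k * (F + B) by rewrite ler_pM2l.
  lra.
have h2 : d * (weight w O - k * B) <= d * (g + k * F) by rewrite ler_pM2l.
have h3 : d * g <= k / (k - 1) * g.
  rewrite ler_wpM2r //; apply: le_trans d1 _.
  by rewrite ler_pdivlMr; lra.
have h4 : 0 <= (k - 2 * d - d * k) * F.
  rewrite mulr_ge0 //.
  have : 0 <= (1/4 - d) * k by rewrite mulr_ge0; lra.
  lra.
lra.
Qed.

Lemma released_mono v : v \notin cover MA -> released (p v) (p' v) (u v) = 0.
Proof. by move=> nv; rewrite released0 // (vweight_mono w_gt0 mM augA nv). Qed.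

Lemma bonus_outside v : v \notin cover MA -> v \in cover A ->
  bonus d (p v) (p' (mu v)) (p' v) = 0.
Proof.
move=> nv vA; rewrite (vweight_new _ augA nv vA) /bonus /heavy ltNge p'_ge0 /=.
by rewrite (min_l (p'_ge0 v)) mulr0.
Qed.

Lemma settled_extra_total :
  \sum_(e in N) extra settled e <= \sum_(e in M) extra L e + \sum_v rho v
    + \sum_(v in cover MA) bonus d (p v) (p' (mu v)) (p' v) + \sum_(e in A) topup e.
Proof.
have bonus0 v : 0 <= bonus d (p v) (p' (mu v)) (p' v) by apply: (bonus_ge0 kd).
rewrite (bigID (mem A)) /= addrC -!addrA; apply: lerD.
  apply: le_trans (_ : \sum_(e in M :\: MA) extra L e <= _).
    rewrite le_eqVlt; apply/orP; left; apply/eqP; apply: eq_big => e.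
      rewrite in_setU; case: (boolP (e \in A)) => [eA|]; last by rewrite orbF andbT.
      by rewrite andbF in_setD (negbTE (augmenting_new augA eA)) andbF.
    by case/andP => _ /negbTE /= ->.
  rewrite [leRHS](big_setID MA) /= lerDr; apply: sumr_ge0 => e _; exact: (bal_extra bL).
rewrite (eq_bigl (mem A)); last first.
  by move=> e; rewrite !inE; case: (e \in A); rewrite ?orbT ?andbF.
rewrite (eq_bigr (fun e : {set T} => \sum_(v in e)
   (rho v + bonus d (p v) (p' (mu v)) (p' v)) + topup e)); last first.
  by move=> e /= ->.
rewrite big_split /= addrA lerD2r -(sum_cover _ mA) big_split /=; apply: lerD.
  rewrite [leRHS](bigID (mem (cover A))) /= lerDl; exact: sumr_ge0.
rewrite (bigID (mem (cover MA))) /= addrC big1 ?add0r; last first.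
  by move=> v /andP[vA nv]; apply: bonus_outside.
rewrite [leRHS](bigID (mem (cover A))) /=.
rewrite (eq_bigl (fun v => (v \in cover MA) && (v \in cover A))).
  by rewrite lerDl sumr_ge0.
by move=> v; rewrite andbC.
Qed.

Lemma removed_budget :
  \sum_(v in cover MA) (k * released (p v) (p' v) (u v)
     + bonus d (p v) (p' (mu v)) (p' v)
     + (k - 1) * secured (p v) (p' (mu v)) (p' v) (u (mu v)))
   <= k * weight w MA - \sum_(f in MA) (if swap_free f then (k - 2 * d) * w f else 0).
Proof.
rewrite (sum_cover _ mMA) /weight mulr_sumr -sumrB; apply: ler_sum => f fMA.
have [x [y [xy ef]]] := edge_ends simpleE (matching_edge mMA fMA).
have xMA : x \in cover MA by apply: (cover_in fMA); rewrite ef set21.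
have [[mx xmMA mxMA mmx pmx] [px [kp wp]]] := removed_pair xMA.
have emf : [set x; mu x] = f.
  by apply: (matching_eq mMA xmMA fMA (set21 _ _)); rewrite ef set21.
rewrite -emf sum_ends 1?eq_sym // mmx pmx wp.
have := pair_budget (u x) (u (mu x)) kd (p'_ge0 x) (p'_ge0 (mu x)) px kp.
have -> : swap_free [set x; mu x] = (p x <= p' x) && (p x <= p' (mu x)).
  apply/forall_inP/andP => [sf|[h1 h2] v].
    by rewrite -[X in X <= p' (mu x)]pmx; split; apply: sf; rewrite !inE eqxx ?orbT.
  by rewrite !inE => /orP[]/eqP->; rewrite ?pmx.
by apply: le_trans; rewrite le_eqVlt eqxx.
Qed.

(** At regained levels the excess falls by [k * rho], which pays [rho] into [extra] and
    [(k - 1) * rho] into banks. Lost levels, bonuses and new banks are paid by [removed_budget]. The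
    top-ups use the gain and what swap-free edges left unspent. *)
Lemma settled_total : 0 <= gain w k M A ->
  \sum_v Num.max 0 (charge settled v - k * p' v)
      + \sum_(e in N) extra settled e + (k - 1) * \sum_v banked settled v
      <= k / (k - 1) * weight w N.
Proof.
move=> g0; have kk := k1; have kk0 := k0.
have rb := removed_budget; rewrite !big_split /= -!mulr_sumr in rb.
have := bal_total bL; have := settled_extra_total; have := topup_total g0.
have : (k - 1) * \sum_v banked settled v <= (k - 1) * (\sum_v banked L v + \sum_v rho v
     + \sum_(v in cover MA) secured (p v) (p' (mu v)) (p' v) (u (mu v))).
  by rewrite ler_wpM2l ?settled_banked_total //; lra.
move: rb; have -> : \sum_(v in cover MA) released (p v) (p' v) (u v) = \sum_v released (p v) (p' v) (u v).
  rewrite [RHS](bigID (mem (cover MA))) /= [X in _ = _ + X]big1 ?addr0 //.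
  exact: released_mono.
have -> : \sum_v Num.max 0 (charge L v - k * p' v)
    = \sum_v Num.max 0 (charge L v - k * p v)
      + k * \sum_v released (p v) (p' v) (u v) - k * \sum_v rho v.
  rewrite !mulr_sumr -big_split -sumrB /=; apply: eq_bigr => v _.
  have := excess_change (p v) (p' v) (charge L v) k0.
  rewrite -[Num.max 0 (Num.min (p v) _ - _)]/(released (p v) (p' v) (u v)).
  rewrite -[Num.max 0 (Num.min (p' v) _ - _)]/(rho v).
  lra.
rewrite (weight_augmented _ augA) /gain.
have -> : k / (k - 1) * (weight w M - weight w MA + weight w A)
   = k / (k - 1) * weight w M + k / (k - 1) * (weight w A - k * weight w MA)
      + k * weight w MA.
  by field; lra.
lra.
Qed.

Lemma credit_ge0 N' L' x y : (forall v, 0 <= reserve L' v) -> (forall v, 0 <= banked L' v) ->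
  0 <= credit S N' L' x y.
Proof.
move=> r0 b0; have kk := k1; have kk0 := k0; have dd0 := kd0.
rewrite /credit; case: ifP => _; last by rewrite !mulr_ge0 // ltW.
by rewrite addr_ge0 ?le_max ?lexx // mulr_ge0 //; lra.
Qed.

Lemma settled_banked_ge0 x : 0 <= banked settled x.
Proof.
case: (boolP (x \in cover MA)) => xMA.
  case: (boolP (heavy_end x)) => hx; last first.
    by rewrite settled_banked_new // /secured -/(heavy_end x) (negbTE hx).
  have [h1 _ _] := heavy_facts xMA hx.
  rewrite /banked settled_gap_new //; have := released_le (u (mu x)) (ltW h1).
  have -> : reserve settled x = p x by rewrite /= /settled_reserve xMA hx.
  have := p'_ge0 (mu x); lra.
by apply: le_trans (settled_banked xMA); case/andP: (banked_bounds bL x).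
Qed.

(** A new edge has one of three sources for its saving: the bonus at an end that lost weight, slack
    and refund at an end in [S] ([seen_credit]), or, with both ends outside [S], the promises of its
    shadow edges completed by [topup]. *)
Lemma settled_edge x y : x != y -> [set x; y] \in N ->
  d * w [set x; y] <= extra settled [set x; y]
    + credit S N settled x y + credit S N settled y x.
Proof.
move=> xy xyN; have kk := k1; have kk0 := k0; have dd0 := kd0.
have cr0 a b : 0 <= credit S N settled a b.
  by apply: credit_ge0 => v; [apply: settled_reserve_ge0|apply: settled_banked_ge0].
have [xyA|nxyA] := boolP ([set x; y] \in A); last first.
  have xyK : [set x; y] \in M :\: MA by case/setUP: xyN => //; rewrite (negbTE nxyA).
  have xyM : [set x; y] \in M by case/setDP: xyK.
  have kept a b : a \in [set x; y] -> b \in [set x; y] ->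
      credit S M L a b <= credit S N settled a b.
    move=> axy bxy; have na := kept_notin_removed mM xyK axy.
    have pb : p' b = p b.
      by rewrite (vweight_same _ mM augA (kept_notin_removed mM xyK bxy)
                   (kept_notin_added augA xyK bxy)).
    rewrite /credit pb; case: ifP => _.
      by rewrite lerD2l ler_wpM2l ?settled_banked //; lra.
    by rewrite /= /settled_reserve (negbTE na).
  have := bal_edge bL xy xyM.
  rewrite /= (negbTE nxyA).
  have := kept x y (set21 _ _) (set22 _ _); have := kept y x (set22 _ _) (set21 _ _).
  lra.
have ends v : v \in [set x; y] -> p' v = w [set x; y].
  by apply: (vweight_added _ mM augA xyA).
have w0 := w_gt0 (matching_edge mA xyA).
have bonus0 v : 0 <= bonus d (p v) (p' (mu v)) (p' v) by apply: (bonus_ge0 kd).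
have part0 v : 0 <= rho v + bonus d (p v) (p' (mu v)) (p' v) by rewrite addr_ge0.
have part_le v : v \in [set x; y] ->
    rho v + bonus d (p v) (p' (mu v)) (p' v) <= extra settled [set x; y].
  move=> vxy; rewrite /= xyA sum_ends //; have := topup_ge0 [set x; y].
  have := part0 x; have := part0 y; move: vxy; rewrite !inE => /orP[]/eqP->; lra.
have [sf|nsf] := boolP (swap_free [set x; y]); last first.
  have [v vxy pv] : exists2 v, v \in [set x; y] & p' v < p v.
    move: nsf; rewrite negb_forall => /existsP[v]; rewrite negb_imply -ltNge => /andP[? ?].
    by exists v.
  have := part_le v vxy; have := rho_ge0 v; have := cr0 x y; have := cr0 y x.
  rewrite /bonus /heavy [p v <= _]leNgt pv andbF (min_r (ltW pv)) ends //; lra.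
have seen a b : a \in [set x; y] -> b \in [set x; y] -> b \in S ->
    d * w [set x; y] <= rho b + bonus d (p b) (p' (mu b)) (p' b) + credit S N settled a b.
  move=> axy bxy bS; have pb : p b <= p' b := forall_inP sf _ bxy.
  rewrite /credit bS ends //.
  have bA := cover_in xyA bxy.
  have kp : k * p b <= p' b + p' (mu b).
    have [bMA|nbMA] := boolP (b \in cover MA); first by have [_ [_ []]] := removed_pair bMA.
    by rewrite (vweight_new _ augA nbMA bA) mulr0 addr_ge0.
  have := seen_credit (charge L b) kd (p_ge0 b) pb (p'_ge0 _) kp.
  have : 0 <= (k - 1) * banked settled a by rewrite mulr_ge0 ?settled_banked_ge0 //; lra.
  rewrite ends //=; lra.
have [yS|nyS] := boolP (y \in S).
  have := seen x y (set21 _ _) (set22 _ _) yS; have := part_le y (set22 _ _).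
  have := cr0 y x; lra.
have [xS|nxS] := boolP (x \in S).
  have := seen y x (set22 _ _) (set21 _ _) xS; have := part_le x (set21 _ _).
  have := cr0 x y; lra.
have : topup [set x; y] <= extra settled [set x; y].
  by rewrite /= xyA lerDr; apply: sumr_ge0.
rewrite /credit (negbTE nyS) (negbTE nxS) /topup -/(swap_free _) sf sum_ends //=.
set rx := settled_reserve x; set ry := settled_reserve y; set W := w _.
have : d * (W - k * (rx + ry)) <= d * Num.max 0 (W - k * (rx + ry)).
  by rewrite ler_pM2l // le_max lexx orbT.
lra.
Qed.

Lemma settled_balanced : 0 <= gain w k M A -> balanced S N settled.
Proof.
move=> g0; split.
- exact: (bal_charge bL).
- exact: settled_reserve_ge0.
- move=> x /=; case: ifP => _ //; by rewrite le_max (bal_lo bL).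
- move=> x /=; case: ifP => _.
    by case: ifP => _ //; rewrite le_max lexx.
  by rewrite ge_max !le_max lexx (bal_gap bL) orbT.
- exact: settled_hi.
- move=> e /=; case: ifP => _; last exact: (bal_extra bL).
  rewrite addr_ge0 ?topup_ge0 // sumr_ge0 // => v _; rewrite addr_ge0 //.
  exact: (bonus_ge0 kd).
- exact: settled_owner.
- exact: settled_meet.
- exact: settled_stack.
- exact: settled_total.
- exact: settled_edge.
Qed.

End Settle.
End Ledger.

(** * Charging an input edge *)

Section Charging.
Variables (R : realFieldType) (T : finType) (E : {set {set T}}) (w : {set T} -> R).
Variables (k d : R).
Hypothesis simpleE : simple_graph E.
Hypothesis w_gt0 : forall e, e \in E -> 0 < w e.
Hypothesis kd : rate k d.
Local Notation vweight := (vweight w).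
Local Notation balanced := (balanced w k d).
Implicit Types (e f o : {set T}) (S : {set T}) (M A Q P : {set {set T}}).
Implicit Types (st : state T) (L : ledger R T).

Let k1 : 1 < k. Proof. by case: kd. Qed.
Let k0 : 0 < k. Proof. exact: lt_trans ltr01 k1. Qed.

Definition recharge (c : T -> R) (L : ledger R T) : ledger R T :=
  Ledger c (reserve L) (lo L) (hi L) (target L) (extra L).

(** Charges only grow, and on [o] they stay within [k * vweight], so no excess arises. The last
    hypothesis is the critical one: slack at [y] and bank of [x] must redeem the promise made while
    [y] was outside [S]. *)
Lemma recharge_balanced (S o : {set T}) M L c : matching E M -> balanced S M L ->
  (forall v, v \notin o -> c v = charge L v) ->
  (forall v, v \in o -> [/\ v \notin S, charge L v = 0 & 0 <= c v <= k * vweight M v]) ->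
  (forall x y, x != y -> [set x; y] \in M -> y \in o ->
     d * k * reserve L x <= k * vweight M y - c y + (k - 1) * banked L x) ->
  balanced (S :|: o) M (recharge c L).
Proof.
move=> mM bL out inn edge; have kk := k1; have kk0 := k0.
have p0 v : 0 <= vweight M v by apply: (vweight_ge0 w_gt0); case/matchingP: mM.
have mono v : charge L v <= c v.
  have [vo|/out->//] := boolP (v \in o).
  by have [_ -> /andP[]] := inn v vo.
split.
- by move=> v; apply: le_trans (mono v); apply: (bal_charge bL).
- exact: (bal_reserve bL).
- exact: (bal_lo bL).
- exact: (bal_gap bL).
- move=> x /=; apply: le_trans (bal_hi bL x) _.
  rewrite ge_max !le_max lexx /= ge_min; apply/orP; right.
  by rewrite le_min ge_min lexx /= ge_min ler_pM2r ?invr_gt0 ?mono ?orbT.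
- exact: (bal_extra bL).
- exact: (bal_owner bL).
- exact: (bal_meet bL).
- move=> a q r paq qr /=; apply: le_trans (bal_stack bL paq qr) _.
  have [ao|/out->//] := boolP (a \in o).
  by rewrite lerD2r clip_mono // ler_pM2r ?invr_gt0.
- have -> : \sum_v Num.max 0 (charge (recharge c L) v - k * vweight M v)
     = \sum_v Num.max 0 (charge L v - k * vweight M v).
    apply: eq_bigr => v _ /=; have [vo|/out->//] := boolP (v \in o).
    have [_ -> /andP[_ cv]] := inn v vo.
    by rewrite !max_l ?subr_le0 // mulr_ge0 // ltW.
  exact: (bal_total bL).
- have cr x y : x != y -> [set x; y] \in M ->
      credit w k d S M L x y <= credit w k d (S :|: o) M (recharge c L) x y.
    move=> xy xyM; rewrite /credit inE /=.
    have bz : banked (recharge c L) x = banked L x by [].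
    have [yo|nyo] := boolP (y \in o); last by rewrite orbF out.
    have [nyS _ _] := inn y yo; rewrite (negbTE nyS) orbT bz.
    by apply: le_trans (edge x y xy xyM yo) _; rewrite lerD2r le_max lexx orbT.
  move=> x y xy xyM; apply: le_trans (bal_edge bL xy xyM) _ => /=.
  have := cr x y xy xyM; have := cr y x; rewrite eq_sym setUC => /(_ xy xyM).
  lra.
Qed.

Lemma coveringE M e v : matching E M -> e \in M -> v \in e -> covering M v = e.
Proof.
move=> mM eM ve; rewrite /covering; case: pickP => [f /andP[fM vf]|/(_ e)] /=.
  exact: matching_eq mM fM eM vf ve.
by rewrite eM ve.
Qed.

Lemma coveringP M v : covering M v = set0 \/ (covering M v \in M /\ v \in covering M v).
Proof. by rewrite /covering; case: pickP => [f /andP[fM vf]|] /=; [right|left]. Qed.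

Lemma augmenting0 M : augmenting E M set0.
Proof. by rewrite /augmenting sub0set; apply/forall_inP => e; rewrite inE. Qed.

Lemma augmenting_add M Q e : e \in E -> e \notin M -> augmenting E M Q ->
  (forall f, f \in Q -> [disjoint e & f]) -> augmenting E M (e |: Q).
Proof.
move=> eE neM augQ disj; have mQ := augmenting_matching augQ.
have [QE mQ'] := matchingP _ _ mQ.
have mU : matching E (e |: Q).
  apply/matchingP; split; first by rewrite subUset sub1set eE.
  have cross f v : f \in Q -> v \in e -> v \in f -> False.
    by move=> fQ ve vf; have /pred0P/(_ v) /= := disj f fQ; rewrite ve vf.
  move=> f g v /setU1P[->|fQ] /setU1P[->|gQ] vf vg //.
  - by case: (cross g v).
  - by case: (cross f v).
  - exact: mQ' fQ gQ vf vg.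
rewrite /augmenting; case/andP: mU => _ ->; rewrite andbT subUset sub1set inE neM eE /=.
by case/andP: augQ.
Qed.

Lemma weight_add Q e : e \notin Q -> weight w (e |: Q) = w e + weight w Q.
Proof. by move=> neQ; rewrite /weight big_setU1. Qed.

(** The algorithm stores more shadow edges than the analysis exploits. Only those with positive
    reserve have to agree with the ledger. *)
Record tracks st (L : ledger R T) : Prop := Tracks {
  shadow_self : forall e v, e \in current st -> v \in e ->
    shadow st e v = set0 \/ v \in shadow st e v;
  shadow_owner : forall e x, e \in current st -> x \in e -> 0 < reserve L x ->
    [/\ shadow st e x = [set x; target L x], [set x; target L x] \in E
      & reserve L x <= w [set x; target L x]] }.

Lemma augment_tracks st A S L : matching E (current st) -> balanced S (current st) L ->
  augmenting E (current st) A -> tracks st L ->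
  tracks (augment st A) (settled w k d (current st) A L).
Proof.
set M := current st => mM bL augA [self own].
have mMA := matching_sub mM (adjacent_in_sub M A).
split=> e x /= /setUP[eK|eA] xe.
- rewrite eK; have [eM _] := setDP eK.
  have -> : e \in A = false by apply/negbTE; apply: contraTN eM => /(augmenting_new augA).
  by case: ifP => _; [left|apply: self].
- rewrite eA xe; case: (coveringP (adjacent_in M A) x) => [->|[_ ?]]; by [left|right].
- rewrite eK; have [eM _] := setDP eK.
  have -> : e \in A = false by apply/negbTE; apply: contraTN eM => /(augmenting_new augA).
  have nxMA := kept_notin_removed mM eK xe.
  rewrite /settled_reserve (negbTE nxMA) => rx.
  have [sx sE rs] := own e x eM xe rx; split=> //.
  rewrite sx; case: ifP => // sA.
  by have := kept_notin_added augA eK xe; rewrite (cover_in sA (set21 _ _)).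
- rewrite eA xe (added_reserve augA bL (cover_in eA xe)).
  case: ifP => [/andP[xMA hx] _|]; last by rewrite ltxx.
  have [f fMA xf] := coverP _ _ xMA.
  have fM := subsetP (adjacent_in_sub _ _) _ fMA.
  have xM := cover_in fM xf; have [mx mxM] := mateP simpleE mM xM.
  have ef : [set x; mate M x] = f := matching_eq mM mxM fM (set21 _ _) xf.
  rewrite xMA ef (coveringE mMA fMA xf); split=> //; first exact: matching_edge mM fM.
  by rewrite (vweightE _ mM fM xf).
Qed.

(* The part of the charge of [y] that is withheld on behalf of its partner. *)
Definition withheld M L y : R :=
  if y \in cover M then
    d * k * Num.max 0 (reserve L (mate M y) - k * banked L (mate M y))
  else 0.

Definition capacity M L y : R := k * vweight M y - withheld M L y.

(** As [k - 1 = d * k * k], a bank of [reserve / k] redeems the promise alone. Below that amount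
    something must be withheld at [y]. *)
Definition critical M L x y : Prop :=
  [/\ x != y, [set x; y] \in M & k * banked L x < reserve L x].

Lemma withheld_critical S M L x y : matching E M -> balanced S M L -> critical M L x y ->
  withheld M L y <= reserve L x - k * banked L x.
Proof.
move=> mM bL [xy xyM cx]; have [_ [_ [_ [dk1 _]]]] := rate_bounds kd.
rewrite /withheld (cover_in xyM (set22 _ _)).
rewrite (@mateE T E M y x) // 1?eq_sym //; last by rewrite setUC.
rewrite max_r; last by lra.
by rewrite ler_piMl //; lra.
Qed.

Lemma withheld0 M L y : matching E M -> (forall x, ~ critical M L x y) ->
  withheld M L y = 0.
Proof.
move=> mM nc; rewrite /withheld; case: ifP => // yM.
have [my myM] := mateP simpleE mM yM.
rewrite max_l ?mulr0 // leNgt; apply/negP => h; apply: (nc (mate M y)); split=> //.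
  by rewrite setUC.
lra.
Qed.

Lemma withheld_bound S M L x y : matching E M -> balanced S M L -> x != y ->
  [set x; y] \in M -> 0 <= withheld M L y <= d * k * w [set x; y].
Proof.
move=> mM bL xy xyM; have kk := k1; have kk0 := k0.
have [d1 [d2 [d3 [dk1 d5]]]] := rate_bounds kd; have d0 := rate_gt0 kd.
rewrite /withheld (cover_in xyM (set22 _ _)).
rewrite (@mateE T E M y x) // 1?eq_sym //; last by rewrite setUC.
have w0 := w_gt0 (matching_edge mM xyM).
have dk0 : 0 <= d * k by rewrite mulr_ge0 // ltW.
rewrite mulr_ge0 ?le_max ?lexx //= ler_wpM2l // ge_max ltW //=.
have /andP[z0 _] := banked_bounds bL x.
have kz : banked L x <= k * banked L x by rewrite ler_peMl // ltW.
have := bal_reserve bL x; rewrite le_eqVlt => /orP[/eqP r0|r0]; first by lra.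
have [_ _ _] := bal_owner bL r0; rewrite (vweightE _ mM xyM (set21 _ _)); lra.
Qed.

Lemma capacity_bounds S M L y : matching E M -> balanced S M L ->
  0 <= capacity M L y <= k * vweight M y.
Proof.
move=> mM bL; rewrite /capacity; case: (boolP (y \in cover M)) => yM; last first.
  by rewrite /withheld (negbTE yM) vweight0 // mulr0 subr0 lexx.
have [my myM] := mateP simpleE mM yM; rewrite setUC in myM.
have /andP[h1 h2] := withheld_bound mM bL my myM.
have w0 := w_gt0 (matching_edge mM myM).
have [d1 [d2 [d3 [dk1 d5]]]] := rate_bounds kd; have kk := k1.
rewrite (vweightE _ mM myM (set22 _ _)).
have : d * k * w [set mate M y; y] <= k * w [set mate M y; y] by rewrite ler_pM2r //; lra.
lra.
Qed.

(** * Bounding the weight of an arriving optimal edge by the capacities of its ends *)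

Section Payment.
Variables (S : {set T}) (M M0 C : {set {set T}}) (L : ledger R T) (o : {set T}).
Hypotheses (mM : matching E M) (bL : balanced S M L) (oE : o \in E) (oM0 : o \notin M0)
  (oC : o \in C).
Hypothesis unpaid : forall v, v \in o -> charge L v = 0.
Hypothesis blocked : forall Q, augmenting E M0 Q -> Q \subset C ->
  weight w Q <= k * \sum_(e in M | ~~ [disjoint e & cover Q]) w e.
Hypothesis usable : forall x y, critical M L x y -> y \in o -> [set x; y] != o ->
  target L x \in o \/
  [/\ [set x; y] \in M0, [set x; target L x] \in E, [set x; target L x] \in C
    & reserve L x <= w [set x; target L x]].
Hypothesis mM0 : matching E M0.

Lemma blocked_by Q (F : {set T}) : augmenting E M0 Q -> Q \subset C ->
  (forall e v, e \in M -> v \in e -> v \in cover Q -> exists2 v', v' \in F & v' \in e) ->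
  weight w Q <= k * \sum_(v in F) vweight M v.
Proof.
move=> augQ QC meets; apply: le_trans (blocked augQ QC) _.
rewrite ler_pM2l ?k0 //; have [ME _] := matchingP _ _ mM.
apply: le_trans (weight_union w_gt0 F ME).
rewrite [leRHS](bigID (fun e : {set T} => ~~ [disjoint e & cover Q])) /=.
rewrite (eq_bigl (fun e => ((e \in M) && ~~ [disjoint e & F]) && ~~ [disjoint e & cover Q])).
  by rewrite lerDl; apply: sumr_ge0 => e /andP[/andP[eM _] _]; apply/ltW/w_gt0/(subsetP ME).
move=> e; case: (boolP (e \in M)) => //= eM.
case: (boolP [disjoint e & cover Q]) => [_|/pred0Pn[v /andP[/= ve vQ]]]; first by rewrite andbF.
have [v' v'F v'e] := meets e v eM ve vQ.
by rewrite andbT; apply/esym/pred0Pn; exists v'; rewrite /= v'e.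
Qed.

(** A critical bank is smaller than the reserve, so the interval is nonempty and the target carries
    a charge. The ends of [o] carry none, hence the target is not among them. Moreover a bank below
    the reserve is at least [lo], which bounds the weight at the target. *)
Lemma critical_facts x y : critical M L x y -> y \in o -> [set x; y] != o ->
  [/\ x \notin o, target L x \notin o, target L x != x & [set x; target L x] \in E] /\
  [/\ [set x; target L x] \notin M0, [set x; target L x] \in C,
      reserve L x <= w [set x; target L x], vweight M (target L x) <= banked L x
    & reserve L x <= vweight M y + banked L x].
Proof.
move=> cxy yo xyo; have [xy xyM cx] := cxy; have kk := k1.
have /andP[z0 zr] := banked_bounds bL x.
have kz : banked L x <= k * banked L x by rewrite ler_peMl // ltW.
have r0 : 0 < reserve L x by lra.
have [xM tx pl rp] := bal_owner bL r0.
have gap := gap_bound bL x; have lo0 := bal_lo bL x.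
have lo_z : lo L x <= banked L x by move: gap cx kz; rewrite /banked; minmax.
have no_gap : charge L (target L x) = 0 -> False.
  move=> c0; have := bal_hi bL x; rewrite c0 mul0r.
  by move: cx kz lo0; rewrite /banked; minmax.
have nt : target L x \notin o by apply/negP => /unpaid/no_gap.
case: (usable cxy yo xyo) => [to|[xyM0 sE sC rs]]; first by rewrite to in nt.
have nx : x \notin o.
  apply: contra xyo => xo; have [z zy eo] := edge_endpoint simpleE oE yo.
  move: xo; rewrite eo !inE (negbTE xy) /= => /eqP->; by rewrite setUC.
split; split=> //.
- apply: contra nt => sM0.
  have /setP/(_ y) := matching_eq mM0 sM0 xyM0 (set21 _ _) (set21 _ _).
  by rewrite !inE eqxx orbT eq_sym (negbTE xy) /= => /eqP <-.
- lra.
- by rewrite (vweightE _ mM xyM (set22 _ _)) -(vweightE _ mM xyM (set21 _ _)).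
Qed.

Lemma critical_disjoint x y : critical M L x y -> y \in o -> [set x; y] != o ->
  [disjoint [set x; target L x] & o].
Proof.
move=> cxy yo xyo; have [[nx nt _ _] _] := critical_facts cxy yo xyo.
apply/pred0P => v /=; rewrite !inE; apply/negP => /andP[/orP[]/eqP->].
  by rewrite (negbTE nx).
by rewrite (negbTE nt).
Qed.

Lemma pay_alone : weight w [set o] <= k * \sum_(v in o) vweight M v.
Proof.
have aug : augmenting E M0 [set o].
  by rewrite -(setU0 [set o]); apply: augmenting_add (augmenting0 _) _ => // f; rewrite inE.
apply: blocked_by; rewrite ?sub1set //.
by move=> e v eM ve /coverP[f /set1P-> vo]; exists v.
Qed.

Lemma pay_one x y (F : {set T}) : critical M L x y -> y \in o -> [set x; y] != o ->
  o \subset F ->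
  (forall e, e \in M -> target L x \in e -> exists2 v, v \in F & v \in e) ->
  w o + w [set x; target L x] <= k * \sum_(v in F) vweight M v.
Proof.
move=> cxy yo xyo oF tF; have [xy xyM _] := cxy; have disj := critical_disjoint cxy yo xyo.
have [[nx _ _ sE] [nsM sC _ _ _]] := critical_facts cxy yo xyo.
set s := [set x; target L x] in sE nsM sC disj *.
have aug : augmenting E M0 (s |: [set o]).
  apply: augmenting_add => //; last by move=> f /set1P->.
  by rewrite -(setU0 [set o]); apply: augmenting_add (augmenting0 _) _ => // f; rewrite inE.
have <- : weight w (s |: [set o]) = w o + w s.
  rewrite weight_add ?/weight ?big_set1 1?addrC // inE.
  by apply: contraNneq nx => <-; rewrite set21.
apply: blocked_by => //; first by rewrite subUset !sub1set sC.
move=> e v eM ve /coverP[f /setU1P[->|/set1P->] vf]; last first.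
  by exists v => //; apply: (subsetP oF).
move: vf; rewrite !inE => /orP[]/eqP vx; last by apply: tF => //; rewrite -vx.
exists y; first exact: (subsetP oF).
by rewrite vx in ve; rewrite (matching_eq mM eM xyM ve (set21 _ _)) set22.
Qed.

Lemma pay_target x y : critical M L x y -> y \in o -> [set x; y] != o ->
  w o + w [set x; target L x]
    <= k * (vweight M (target L x) + \sum_(v in o) vweight M v).
Proof.
move=> cxy yo xyo; have [[_ nt _ _] _] := critical_facts cxy yo xyo.
have := @pay_one x y (target L x |: o) cxy yo xyo (subsetUr _ _).
rewrite big_setU1 //=; apply=> e eM te.
by exists (target L x) => //; rewrite setU11.
Qed.

Lemma pay_two x1 y1 x2 y2 : critical M L x1 y1 -> critical M L x2 y2 ->
  y1 \in o -> y2 \in o -> [set x1; y1] != o -> [set x2; y2] != o ->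
  [disjoint [set x1; target L x1] & [set x2; target L x2]] ->
  w o + w [set x1; target L x1] + w [set x2; target L x2]
    <= k * (\sum_(v in o) vweight M v + vweight M (target L x1) + vweight M (target L x2)).
Proof.
move=> c1 c2 y1o y2o e1o e2o d12.
have [xy1 xyM1 _] := c1; have [xy2 xyM2 _] := c2.
have disj1 := critical_disjoint c1 y1o e1o; have disj2 := critical_disjoint c2 y2o e2o.
have [[nx1 nt1 _ sE1] [nsM1 sC1 _ _ _]] := critical_facts c1 y1o e1o.
have [[nx2 nt2 _ sE2] [nsM2 sC2 _ _ _]] := critical_facts c2 y2o e2o.
set s1 := [set x1; _] in d12 disj1 sE1 nsM1 sC1 *.
set s2 := [set x2; _] in d12 disj2 sE2 nsM2 sC2 *.
have s1o : s1 != o by apply: contraNneq nx1 => <-; rewrite set21.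
have s2o : s2 != o by apply: contraNneq nx2 => <-; rewrite set21.
have s12 : s1 != s2.
  by apply/eqP => e12; have /pred0P/(_ x1) := d12; rewrite /= -e12 set21.
have aug : augmenting E M0 (s1 |: (s2 |: [set o])).
  apply: augmenting_add => //; last by move=> f /setU1P[->|/set1P->].
  apply: augmenting_add => //; last by move=> f /set1P->.
  by rewrite -(setU0 [set o]); apply: augmenting_add (augmenting0 _) _ => // f; rewrite inE.
have <- : weight w (s1 |: (s2 |: [set o])) = w o + w s1 + w s2.
  rewrite !weight_add ?inE ?negb_or ?s12 ?s1o ?s2o //.
  by rewrite /weight big_set1; lra.
have t12 : target L x1 != target L x2.
  apply/eqP => t12; have /pred0P/(_ (target L x1)) := d12.
  by rewrite /= set22 t12 set22.
have -> : \sum_(v in o) vweight M v + vweight M (target L x1) + vweight M (target L x2)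
   = \sum_(v in target L x1 |: (target L x2 |: o)) vweight M v.
  by rewrite !big_setU1 ?inE ?negb_or ?t12 ?nt1 //=; lra.
apply: blocked_by => //; first by rewrite !subUset !sub1set sC1 sC2.
have inner x y e : critical M L x y -> y \in o -> e \in M -> x \in e -> y \in e.
  move=> [xy xyM _] _ eM xe.
  by rewrite (matching_eq mM eM xyM xe (set21 _ _)) set22.
move=> e v eM ve /coverP[f /setU1P[->|/setU1P[->|/set1P->]] vf].
- move: vf; rewrite !inE => /orP[]/eqP vx; rewrite vx in ve; last first.
    by exists (target L x1) => //; rewrite !inE eqxx.
  by exists y1; [rewrite !inE y1o !orbT | apply: inner c1 y1o eM ve].
- move: vf; rewrite !inE => /orP[]/eqP vx; rewrite vx in ve; last first.
    by exists (target L x2) => //; rewrite !inE eqxx orbT.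
  by exists y2; [rewrite !inE y2o !orbT | apply: inner c2 y2o eM ve].
- by exists v => //; rewrite !inE vf !orbT.
Qed.

Lemma critical_or_none y : (exists x, critical M L x y) \/ (forall x, ~ critical M L x y).
Proof.
case: (boolP (y \in cover M)) => yM; last first.
  by right=> x [_ xyM _]; rewrite (cover_in xyM (set22 _ _)) in yM.
have [my myM] := mateP simpleE mM yM.
case: (ltP (k * banked L (mate M y)) (reserve L (mate M y))) => h.
  by left; exists (mate M y); split=> //; rewrite setUC.
right=> x [xy xyM]; have <- : mate M y = x.
  by apply: (mateE mM); rewrite 1?eq_sym // setUC.
by rewrite ltNge h.
Qed.

(** Only one of the two shadow edges can accompany [o], and it pays for what is withheld on its own
    behalf. What is withheld for the other one must be covered by the banks. Since
    [banked L x1 < reserve L x1], the hypothesis on the minimum means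
    [reserve L x2 <= banked L x1]. *)
Lemma pay_overlap x1 y1 x2 y2 : y1 != y2 -> o = [set y1; y2] ->
  critical M L x1 y1 -> critical M L x2 y2 -> [set x1; y1] != o -> [set x2; y2] != o ->
  ~~ [disjoint [set x1; target L x1] & [set x2; target L x2]] ->
  Num.min (reserve L x1) (reserve L x2) <= banked L x1 ->
  w o <= capacity M L y1 + capacity M L y2.
Proof.
move=> y12 eo c1 c2 e1o e2o; have kk := k1.
have y1o : y1 \in o by rewrite eo set21.
have y2o : y2 \in o by rewrite eo set22.
have [[nx1 nt1 tx1 sE1] [nsM1 sC1 rs1 pz1 rp1]] := critical_facts c1 y1o e1o.
have [[nx2 nt2 tx2 sE2] [nsM2 sC2 rs2 pz2 rp2]] := critical_facts c2 y2o e2o.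
have wh1 := withheld_critical mM bL c1; have wh2 := withheld_critical mM bL c2.
have [xy1 xyM1 lt1] := c1; have [xy2 xyM2 lt2] := c2.
have so F : \sum_(v in o) F v = F y1 + F y2 :> R by rewrite eo sum_ends.
have /andP[z10 _] := banked_bounds bL x1; have /andP[z20 _] := banked_bounds bL x2.
have kz1 : banked L x1 <= k * banked L x1 by rewrite ler_peMl // ltW.
have kz2 : banked L x2 <= k * banked L x2 by rewrite ler_peMl // ltW.
have p0 v : 0 <= vweight M v by apply: (vweight_ge0 w_gt0); case/matchingP: mM.
rewrite /capacity => /pred0Pn[v /andP[/= v1 v2]] zmin.
have z1 : reserve L x2 <= banked L x1 by move: zmin; minmax.
have x12 : x1 != x2.
  apply: contraNneq e1o => x12; rewrite -x12 in xyM2.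
  have := matching_eq mM xyM2 xyM1 (set21 _ _) (set21 _ _) => e12.
  have : y2 \in [set x1; y1] by rewrite -e12 set22.
  rewrite !inE eq_sym [y2 == y1]eq_sym (negbTE y12) orbF => /eqP x1y2.
  by move: nx1; rewrite x1y2 y2o.
have p_at x y : [set x; y] \in M -> vweight M x = vweight M y.
  by move=> xyM; rewrite !(vweightE _ mM xyM) ?set21 ?set22.
have touch x y z : [set x; y] \in M -> z = x -> y \in o ->
    forall e, e \in M -> z \in e -> exists2 v, v \in o & v \in e.
  move=> xyM -> yo e eM xe; exists y => //.
  by rewrite (matching_eq mM eM xyM xe (set21 _ _)) set22.
(* The second shadow edge ends at [x1], so the edge there is already counted at [y1]. The reserve of
   [x1] is at most [vweight M y1 + banked L x1], and that weight is at most [banked L x2]. *)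
have [t2x1|t2x1] := eqVneq (target L x2) x1.
  have := pay_one c2 y2o e2o (subxx _) (touch _ _ _ xyM1 t2x1 y1o).
  rewrite so; rewrite t2x1 (p_at _ _ xyM1) in pz2.
  have : k * vweight M y1 <= k * banked L x2 by rewrite ler_pM2l ?k0.
  have := p0 y1; have : vweight M y1 <= k * vweight M y1 by rewrite ler_peMl // ltW.
  lra.
have [t1x2|t1x2] := eqVneq (target L x1) x2.
  have := pay_one c1 y1o e1o (subxx _) (touch _ _ _ xyM2 t1x2 y2o).
  rewrite so; lra.
have t12 : target L x1 = target L x2.
  move: v1 v2; rewrite !inE => /orP[]/eqP-> /orP[]/eqP vv //.
  - by rewrite vv eqxx in x12.
  - by rewrite vv eqxx in t2x1.
  - by rewrite vv eqxx in t1x2.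
have := pay_target c1 y1o e1o; rewrite so.
have : k * vweight M (target L x1) <= k * banked L x2 by rewrite t12 ler_pM2l ?k0.
lra.
Qed.

Lemma capacity_total : w o <= \sum_(v in o) capacity M L v.
Proof.
have kk := k1; have [y1 [y2 [y12 eo]]] := edge_ends simpleE oE.
have y1o : y1 \in o by rewrite eo set21.
have y2o : y2 \in o by rewrite eo set22.
have so F : \sum_(v in o) F v = F y1 + F y2 :> R by rewrite eo sum_ends.
have p0 v : 0 <= vweight M v by apply: (vweight_ge0 w_gt0); case/matchingP: mM.
have cap0 v : 0 <= capacity M L v by case/andP: (capacity_bounds v mM bL).
(* If [o] itself has entered M, one end alone can pay, because at most
   [d * k * w o <= (k - 1) * w o] is withheld there. *)
rewrite so; have [oM|noM] := boolP (o \in M).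
  have w0 := w_gt0 oE; have [_ [_ [dk _]]] := rate_bounds kd.
  have y12M : [set y1; y2] \in M by rewrite -eo.
  have := withheld_bound mM bL y12 y12M; rewrite -eo => /andP[_ h].
  have := cap0 y1; rewrite [capacity M L y2]/capacity (vweightE _ mM oM y2o).
  have : d * k * w o <= (k - 1) * w o by rewrite ler_pM2r.
  lra.
have neo x y : critical M L x y -> [set x; y] != o.
  by move=> [_ xyM _]; apply: contraNneq noM => <-.
case: (critical_or_none y1) => [[x1 c1]|nc1]; case: (critical_or_none y2) => [[x2 c2]|nc2].
- have e1o := neo _ _ c1; have e2o := neo _ _ c2.
  have [meet|] := boolP [disjoint [set x1; target L x1] & [set x2; target L x2]].
    have := pay_two c1 c2 y1o y2o e1o e2o meet; rewrite so /capacity.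
    have [_ [_ _ rs1 pz1 _]] := critical_facts c1 y1o e1o.
    have [_ [_ _ rs2 pz2 _]] := critical_facts c2 y2o e2o.
    have := withheld_critical mM bL c1; have := withheld_critical mM bL c2.
    have : k * vweight M (target L x1) <= k * banked L x1 by rewrite ler_pM2l ?k0.
    have : k * vweight M (target L x2) <= k * banked L x2 by rewrite ler_pM2l ?k0.
    lra.
  move=> meet; have [_ _ lt1] := c1; have [_ _ lt2] := c2.
  have pos x y : critical M L x y -> 0 < reserve L x.
    move=> [_ _]; apply: le_lt_trans; apply: mulr_ge0; first by rewrite ltW ?k0.
    by case/andP: (banked_bounds bL x).
  have x12 : x1 != x2.
    apply/eqP => x12; have [_ xyM1 _] := c1; have [_ xyM2 _] := c2; rewrite -x12 in xyM2.
    have e12 := matching_eq mM xyM2 xyM1 (set21 _ _) (set21 _ _).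
    have : y2 \in [set x1; y1] by rewrite -e12 set22.
    have [[nx1 _ _ _] _] := critical_facts c1 y1o e1o.
    rewrite !inE [y2 == y1]eq_sym (negbTE y12) orbF => /eqP x1y2.
    by move: nx1; rewrite -x1y2 y2o.
  case: (bal_meet bL (pos _ _ c1) (pos _ _ c2) x12 meet) => h.
    exact: pay_overlap c1 c2 e1o e2o meet h.
  rewrite addrC; apply: pay_overlap c2 c1 e2o e1o _ _; rewrite 1?eq_sym //.
  - by rewrite eo setUC.
  - by rewrite disjoint_sym.
  - by rewrite minC.
- have e1o := neo _ _ c1; have [[_ nt1 _ _] [_ _ rs1 pz1 _]] := critical_facts c1 y1o e1o.
  have := withheld_critical mM bL c1; rewrite /capacity (withheld0 mM nc2).
  have := pay_target c1 y1o e1o; rewrite so.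
  have : k * vweight M (target L x1) <= k * banked L x1 by rewrite ler_pM2l ?k0.
  lra.
- have e2o := neo _ _ c2; have [[_ nt2 _ _] [_ _ rs2 pz2 _]] := critical_facts c2 y2o e2o.
  have := withheld_critical mM bL c2; rewrite /capacity (withheld0 mM nc1).
  have := pay_target c2 y2o e2o; rewrite so.
  have : k * vweight M (target L x2) <= k * banked L x2 by rewrite ler_pM2l ?k0.
  lra.
- have := pay_alone; rewrite so /weight big_set1 /capacity !withheld0 //; lra.
Qed.

End Payment.

End Charging.

(** * Runs of the algorithm *)

Section Run.
Variables (R : realFieldType) (T : finType) (E : {set {set T}}) (w : {set T} -> R).
Variables (k d : R).
Hypothesis simpleE : simple_graph E.
Hypothesis w_gt0 : forall e, e \in E -> 0 < w e.
Hypothesis kd : rate k d.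
Local Notation vweight := (vweight w).
Local Notation balanced := (balanced w k d).
Implicit Types (e f o : {set T}) (S : {set T}) (M A Q P : {set {set T}}).
Implicit Types (st : state T) (L : ledger R T).

Let k1 : 1 < k. Proof. by case: kd. Qed.
Let k0 : 0 < k. Proof. exact: lt_trans ltr01 k1. Qed.

Variable Mstar : {set {set T}}.
Hypothesis mMstar : matching E Mstar.

(** [P] collects the edges read so far, and [Mstar] is a reference matching known only to the
    analysis. That stored shadow edges lie in [P] ensures that M never contains an edge before its
    arrival. *)
Record invariant P st L : Prop := Invariant {
  inv_matching : matching E (current st);
  inv_past : current st \subset P;
  inv_shadow_past : forall e v, e \in current st -> v \in e ->
    shadow st e v = set0 \/ shadow st e v \in P;
  inv_balanced : balanced (cover (Mstar :&: P)) (current st) L;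
  inv_tracks : tracks E w st L;
  inv_paid : forall o, o \in Mstar -> o \in P -> w o <= \sum_(v in o) charge L v;
  inv_unseen : forall v, v \notin cover (Mstar :&: P) -> charge L v = 0 }.

Lemma set0_notin : set0 \notin E.
Proof. by apply/negP => /(forall_inP simpleE); rewrite cards0. Qed.

Lemma candidatesP st o e : e \in candidates st o -> e \in E -> e \notin current st ->
  e = o \/ exists y g, [/\ y \in o, covering (current st) y \in current st,
    y \in covering (current st) y, g \in covering (current st) y
    & g != y /\ e = shadow st (covering (current st) y) g].
Proof.
set M := current st => eC eE neM.
have not_cov x : e <> covering M x.
  by move=> ex; case: (coveringP M x) => [c0|[cM _]]; move: eE neM; rewrite ex ?c0 ?cM //
    (negbTE set0_notin).
case/setU1P: eC => [->|/bigcupP[y yo /setU1P[/not_cov//|/bigcupP[g /setD1P[gy gc]]]]].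
  by left.
case/setU1P => [->|/imsetP[a _ /not_cov//]]; right; exists y, g.
by case: (coveringP M y) gc => [->|[? ?] ?]; [rewrite inE|split].
Qed.

Lemma candidates_shadow st o y x : matching E (current st) -> x != y ->
  [set x; y] \in current st -> y \in o -> shadow st [set x; y] x \in candidates st o.
Proof.
move=> mM xy xyM yo; apply/setU1r/bigcupP; exists y => //.
rewrite /branch (coveringE mM xyM (set22 _ _)); apply/setU1r/bigcupP.
by exists x; [rewrite !inE xy eqxx | rewrite setU11].
Qed.

Lemma augment_candidates_past P st L o A : invariant P st L ->
  augmenting E (current st) A -> A \subset candidates st o ->
  current (augment st A) \subset o |: P.
Proof.
move=> inv augA AC; apply/subsetP => e /setUP[/setDP[eM _]|eA].
  by apply/setU1r/(subsetP (inv_past inv)).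
have eE := matching_edge (augmenting_matching augA) eA.
case: (candidatesP (subsetP AC e eA) eE (augmenting_new augA eA)) => [->|].
  exact: setU11.
case=> y [g [_ cM yc gc [_ es]]]; case: (inv_shadow_past inv cM gc) => h.
  by rewrite es h (negbTE set0_notin) in eE.
by rewrite es setU1r.
Qed.

Definition rejects st st' o : Prop := forall Q, augmenting E (current st) Q ->
  Q \subset candidates st o ->
  weight w Q <= k * \sum_(e in current st' | ~~ [disjoint e & cover Q]) w e.

Definition reachable st st' o L : Prop := forall x y,
  critical k (current st') L x y -> y \in o -> [set x; y] != o ->
  target L x \in o \/
  [/\ [set x; y] \in current st, [set x; target L x] \in E,
      [set x; target L x] \in candidates st o & reserve L x <= w [set x; target L x]].

Lemma critical_reserve S M L x y : balanced S M L -> critical k M L x y -> 0 < reserve L x.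
Proof.
move=> bL [_ _]; apply: le_lt_trans; apply: mulr_ge0; first by rewrite ltW ?k0.
by case/andP: (banked_bounds bL x).
Qed.

Lemma unchanged_rejects P st L o A : invariant P st L -> optimal E w k st o A ->
  gain w k (current st) A <= 0 -> rejects st st o.
Proof.
move=> inv [_ opt] g0 Q augQ QC; set M := current st.
have N0 : (M :\: adjacent_in M set0) :|: set0 = M.
  rewrite setU0; apply/setDidPl/pred0P => e /=; apply/negP => /andP[_].
  by move=> /adjacent_in_ex[a [v []]]; rewrite inE.
have gain0 : gain w k M set0 = 0.
  have M0 : adjacent_in M set0 = set0.
    apply/setP => e; rewrite [RHS]inE; apply/negP.
    by move=> /adjacent_in_ex[a [v []]]; rewrite inE.
  by rewrite /gain M0 /weight big_set0 mulr0 subr0.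
have := @unprofitable R T E w simpleE w_gt0 k M set0 k0 (inv_matching inv)
  (augmenting0 _ _) Q (ltW k1) augQ; rewrite N0; apply => A' sA' augA'.
rewrite gain0; apply: le_trans g0; apply: opt; rewrite augA' /=.
by apply: subset_trans sA' _; rewrite setU0.
Qed.

Lemma unchanged_reachable P st L o : invariant P st L -> reachable st st o L.
Proof.
move=> inv x y cxy yo _; right; have [xy xyM _] := cxy.
have r0 := critical_reserve (inv_balanced inv) cxy.
have [sx sE rs] := shadow_owner (inv_tracks inv) xyM (set21 _ _) r0; split=> //.
by rewrite -sx; apply: candidates_shadow (inv_matching inv) _ _ _.
Qed.

Lemma changed_rejects P st L o A : invariant P st L -> optimal E w k st o A ->
  rejects st (augment st A) o.
Proof.
move=> inv [/andP[augA AC] opt] Q augQ QC.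
apply: (unprofitable simpleE w_gt0 k0 (inv_matching inv) augA (ltW k1) augQ) => A' sA' augA'.
by apply: opt; rewrite augA' /=; apply: subset_trans sA' _; rewrite subUset QC.
Qed.

(** A kept edge retains its stored shadow edge. An added edge [xy] other than [o] was itself a
    shadow edge, stored at [x] for an edge of M between [x] and the other end of [o]. That edge is
    removed and becomes the shadow edge at [x], so the target lies in [o]. *)
Lemma changed_reachable P st L o A : invariant P st L -> o \in E -> o \notin P ->
  augmenting E (current st) A -> A \subset candidates st o ->
  balanced (cover (Mstar :&: P)) (current (augment st A)) (settled w k d (current st) A L) ->
  reachable st (augment st A) o (settled w k d (current st) A L).
Proof.
move=> inv oE noP augA AC bL' x y cxy yo exo; have [xy xyN _] := cxy.
have mM := inv_matching inv; set M := current st in mM *.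
have r0 := critical_reserve bL' cxy.
have tr := augment_tracks simpleE mM (inv_balanced inv) augA (inv_tracks inv).
have [sx sE rs] := shadow_owner tr xyN (set21 _ _) r0.
have noM : o \notin M by apply: contra noP; apply: (subsetP (inv_past inv)).
case/setUP: (xyN) => [xyK|xyA].
  right; have [xyM _] := setDP xyK; split=> //.
  move: sx; rewrite /= xyK; case: ifP => xyA; first by move: (augmenting_new augA xyA); rewrite xyM.
  case: ifP => [_ s0|_ <-]; last exact: candidates_shadow.
  by have /setP/(_ x) := s0; rewrite !inE eqxx.
have xyE := matching_edge (augmenting_matching augA) xyA.
left; case: (candidatesP (subsetP AC _ xyA) xyE (augmenting_new augA xyA)) => [/eqP|].
  by rewrite (negbTE exo).
case=> y' [g [y'o cM y'c gc [gy' es]]].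
have gxy : g \in [set x; y].
  case: (shadow_self (inv_tracks inv) cM gc) => [s0|]; last by rewrite -es.
  by rewrite es s0 (negbTE set0_notin) in xyE.
have [z zy' eo] := edge_endpoint simpleE oE y'o.
have [z' z'y' ec] := edge_endpoint simpleE (matching_edge mM cM) y'c.
have gz' : g = z' by move: gc; rewrite ec !inE (negbTE gy') /= => /eqP.
have gx : g = x.
  move: gxy; rewrite !inE => /orP[/eqP->//|/eqP gy].
  have yz : y = z.
    by move: yo; rewrite eo !inE -gy (negbTE gy') /= => /eqP.
  by move: cM; rewrite ec -gz' gy yz -eo (negbTE noM).
have cMA : covering M y' \in adjacent_in M A.
  by apply: (adjacent_in_meet augA xyA cM (set21 _ _)); rewrite -gx.
have xMA : x \in cover (adjacent_in M A) by apply: (cover_in cMA); rewrite -gx.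
rewrite /= xMA; have -> : mate M x = y'; last by [].
apply: mateE mM _ _; first by rewrite -gx.
by rewrite -gx gz' setUC -ec.
Qed.

Lemma charge_invariant P st st' L L' o : invariant P st L -> o \in E -> o \notin P ->
  matching E (current st') -> current st' \subset o |: P -> tracks E w st' L' ->
  (forall e v, e \in current st' -> v \in e ->
    shadow st' e v = set0 \/ shadow st' e v \in o |: P) ->
  balanced (cover (Mstar :&: P)) (current st') L' -> charge L' = charge L ->
  rejects st st' o -> reachable st st' o L' ->
  exists L'', invariant (o |: P) st' L''.
Proof.
move=> inv oE noP mM' past' tr' shp' bL' eL rej rea.
have [oMs|noMs] := boolP (o \in Mstar); last first.
  have eP : Mstar :&: (o |: P) = Mstar :&: P.
    by apply/setP => e; rewrite !inE; case: eqP => // ->; rewrite (negbTE noMs).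
  exists L'; split; rewrite ?eP ?eL //; last exact: (inv_unseen inv).
  move=> o' o'Ms /setU1P[o'o|o'P]; first by rewrite -o'o o'Ms in noMs.
  exact: (inv_paid inv).
have eP : Mstar :&: (o |: P) = o |: (Mstar :&: P).
  by apply/setP => e; rewrite !inE; case: eqP => // ->; rewrite oMs.
have cov : cover (o |: (Mstar :&: P)) = cover (Mstar :&: P) :|: o.
  by rewrite /cover bigcup_setU big_set1 setUC.
have fresh v : v \in o -> v \notin cover (Mstar :&: P).
  move=> vo; apply/coverP => -[e /setIP[eMs eP'] ve].
  by rewrite (matching_eq mMstar oMs eMs vo ve) eP' in noP.
have unpaid v : v \in o -> charge L' v = 0.
  by move=> vo; rewrite eL (inv_unseen inv) ?fresh.
have noM : o \notin current st by apply: contra noP; apply: (subsetP (inv_past inv)).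
have total : w o <= \sum_(v in o) capacity w k d (current st') L' v.
  apply: (capacity_total simpleE w_gt0 kd mM' bL' oE noM _ unpaid rej rea (inv_matching inv)).
  exact: setU11.
pose c v := if v \in o then capacity w k d (current st') L' v else charge L' v.
have cap_ok v : 0 <= capacity w k d (current st') L' v <= k * vweight (current st') v.
  exact: (capacity_bounds simpleE w_gt0 kd v mM' bL').
exists (recharge c L'); split=> //.
- rewrite eP cov; apply: (recharge_balanced w_gt0 kd mM' bL').
  + by move=> v nv; rewrite /c (negbTE nv).
  + by move=> v vo; rewrite fresh // unpaid // /c vo cap_ok.
  move=> x y xy xyM yo; rewrite /c yo /capacity /withheld (cover_in xyM (set22 _ _)).
  rewrite (mateE mM' _ (_ : [set y; x] \in _)) 1?eq_sym //; last by rewrite setUC.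
  have [kk dk] := kd.
  (* This is where the value of [d] matters: [d * k ^+ 2 = k - 1] makes withheld charge and bank add
     up to the promise [d * k * reserve]. *)
  have -> : (k - 1) * banked L' x = d * k * (k * banked L' x).
    by rewrite -dk; ring.
  have : d * k * (reserve L' x - k * banked L' x)
      <= d * k * Num.max 0 (reserve L' x - k * banked L' x).
    have d0 := rate_gt0 kd.
    by rewrite ler_wpM2l ?le_max ?lexx ?orbT // mulr_ge0 // ltW ?k0.
  lra.
- by case: tr'.
- move=> o' o'Ms /setU1P[->|o'P].
    by apply: le_trans total _; apply: ler_sum => v vo; rewrite /= /c vo.
  apply: le_trans (inv_paid inv o'Ms o'P) _; apply: ler_sum => v vo'.
  have nvo : v \notin o.
    apply: contra noP => vo.
    by rewrite (matching_eq mMstar oMs o'Ms vo vo').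
  by rewrite /= /c (negbTE nvo) eL.
- move=> v; rewrite eP cov inE negb_or => /andP[nv nvo].
  by rewrite /= /c (negbTE nvo) eL (inv_unseen inv).
Qed.

Lemma step_invariant P st st' L o : invariant P st L -> o \in E -> o \notin P ->
  step E w k st o st' -> exists L', invariant (o |: P) st' L'.
Proof.
move=> inv oE noP [A opt ->]; have [/andP[augA AC] best] := opt.
have mM := inv_matching inv; have bL := inv_balanced inv.
case: ltP => g0; last first.
  apply: (charge_invariant (L' := L) inv oE noP) => //.
  - exact: subset_trans (inv_past inv) (subsetUr _ _).
  - exact: (inv_tracks inv).
  - move=> e v eM ve; case: (inv_shadow_past inv eM ve) => h; first by left.
    by right; rewrite setU1r.
  - exact: unchanged_rejects inv opt g0.
  - exact: unchanged_reachable inv.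
have bL' := settled_balanced simpleE w_gt0 kd mM augA bL.
have optA A' : A' \subset A -> gain w k (current st) A' <= gain w k (current st) A.
  move=> sA; apply: best; rewrite (augmenting_sub sA augA) /=.
  exact: subset_trans sA AC.
have {}bL' := bL' optA (ltW g0).
apply: (charge_invariant (L' := settled w k d (current st) A L) inv oE noP) => //.
- exact: augmented_matching.
- exact: augment_candidates_past inv augA AC.
- exact (augment_tracks simpleE mM bL augA (inv_tracks inv)).
- move=> e v /= eN ve; rewrite ve.
  have [eA|neA] := boolP (e \in A).
    case: (coveringP (adjacent_in (current st) A) v) => [->|[cMA _]]; first by left.
    right; apply/setU1r/(subsetP (inv_past inv)).
    exact: (subsetP (adjacent_in_sub _ _) _ cMA).
  have eK : e \in current st :\: adjacent_in (current st) A.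
    by case/setUP: eN => //; rewrite (negbTE neA).
  rewrite eK; have [eM _] := setDP eK; case: ifP => _; first by left.
  by case: (inv_shadow_past inv eM ve) => h; [left|right; rewrite setU1r].
- exact: changed_rejects inv opt.
- exact: changed_reachable inv oE noP augA AC bL'.
Qed.

Lemma run_invariant s P st st' L : invariant P st L -> uniq s ->
  (forall o, o \in s -> o \in E /\ o \notin P) -> run E w k st s st' ->
  exists L', invariant (P :|: [set o in s]) st' L'.
Proof.
elim: s P st L => [|o s IH] P st L inv /= us sE.
  move=> ->; exists L; have -> // : P :|: [set x in [::]] = P.
  by apply/setP => e; rewrite !inE in_nil orbF.
case=> st1 st_o run_s; have [nos us'] := andP us.
have [oE noP] := sE o (mem_head _ _).
have [L1 inv1] := step_invariant inv oE noP st_o.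
have -> : P :|: [set x in o :: s] = (o |: P) :|: [set x in s].
  by apply/setP => e; rewrite !inE; case: (e == o); rewrite ?orbT.
apply: (IH _ _ _ inv1) => // o' o's; have [o'E no'P] := sE o' (mem_behead (s := o :: s) o's).
by split=> //; rewrite in_setU1 negb_or no'P andbT; apply: contraNneq nos => <-.
Qed.

Lemma initial_invariant : exists L, invariant set0 (initial T) L.
Proof.
exists (Ledger (fun=> 0) (fun=> 0) (fun=> 0) (fun=> 0) id (fun=> 0)).
have v0 v : vweight set0 v = 0 by rewrite vweight0 // /cover big_set0 inE.
have cov0 : cover (Mstar :&: set0) = set0 by rewrite setI0 /cover big_set0.
split=> //=; rewrite ?cov0.
- by apply/matchingP; rewrite sub0set; split=> // e f v; rewrite inE.
- by move=> e v; rewrite inE.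
- split=> //=.
  + by move=> x; rewrite le_max lexx.
  + by move=> x; rewrite ltxx.
  + by move=> x y; rewrite ltxx.
  + move=> a q r; rewrite v0 => q0 qr; rewrite mul0r /clip (max_r q0) (min_l qr).
    by rewrite big1 ?subrr // => x _; rewrite subrr.
  + rewrite /weight !big_set0 mulr0 addr0 !big1 ?mulr0 ?addr0 //.
      by move=> v _; rewrite /banked /= !subrr.
    by move=> v _; rewrite v0 mulr0 subrr maxxx.
  + by move=> x y _; rewrite inE.
- by split=> e v /=; rewrite inE.
- by move=> o _; rewrite inE.
Qed.

(** The charge beyond [k] times the weight is paid by [bal_total]. The rest is at most [2 * k * w e]
    on each edge of M, less the saving from [bal_edge]. The sums of [extra] and banks that enter
    this saving cancel against [bal_total]. *)
Lemma invariant_bound P st L : invariant P st L -> Mstar \subset P ->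
  weight w Mstar <= (2 * k - d + k / (k - 1)) * weight w (current st).
Proof.
move=> inv MsP; have mM := inv_matching inv; have bL := inv_balanced inv.
set M := current st in mM bL *; have kk := k1; have kk0 := k0.
have [d1 [d2 [d3 [d4 d5]]]] := rate_bounds kd; have d0 := rate_gt0 kd.
have p0 v : 0 <= vweight M v by apply: (vweight_ge0 w_gt0); case/matchingP: mM.
have c0 := bal_charge bL.
have h1 : weight w Mstar <= \sum_v charge L v.
  apply: le_trans (_ : \sum_(v in cover Mstar) charge L v <= _).
    rewrite (sum_cover _ mMstar); apply: ler_sum => o oMs.
    by apply: (inv_paid inv) => //; apply: (subsetP MsP).
  by rewrite [leRHS](bigID (mem (cover Mstar))) /= lerDl sumr_ge0.
have h2 : \sum_v charge L v = \sum_v Num.max 0 (charge L v - k * vweight M v)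
    + \sum_v Num.min (charge L v) (k * vweight M v).
  by rewrite -big_split /=; apply: eq_bigr => v _; minmax.
have h3 : \sum_v Num.min (charge L v) (k * vweight M v)
    <= (2 * k - d) * weight w M + \sum_(e in M) extra L e
       + (k - 1) * \sum_v banked L v.
  rewrite (bigID (mem (cover M))) /= [X in _ + X]big1 ?addr0; last first.
    by move=> v nv; rewrite vweight0 // mulr0 min_r.
  apply: le_trans (_ : _ <= (2 * k - d) * weight w M + \sum_(e in M) extra L e
       + (k - 1) * \sum_(v in cover M) banked L v) _; last first.
    rewrite lerD2l ler_wpM2l //; first lra.
    rewrite [leRHS](bigID (mem (cover M))) /= lerDl sumr_ge0 // => v _.
    by case/andP: (banked_bounds bL v).
  rewrite !(sum_cover _ mM) /weight !mulr_sumr -!big_split /=.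
  apply: ler_sum => e eM; have [x [y [xy ee]]] := edge_ends simpleE (matching_edge mM eM).
  have w0 := w_gt0 (matching_edge mM eM).
  have ex := bal_extra bL e.
  have px : vweight M x = w e by apply: (vweightE _ mM eM); rewrite ee set21.
  have py : vweight M y = w e by apply: (vweightE _ mM eM); rewrite ee set22.
  have := @bal_edge _ _ _ _ _ _ _ _ bL x y xy; rewrite -ee => /(_ eM).
  have /andP[zx _] := banked_bounds bL x; have /andP[zy _] := banked_bounds bL y.
  have zx' : 0 <= (k - 1) * banked L x by rewrite mulr_ge0 //; lra.
  have zy' : 0 <= (k - 1) * banked L y by rewrite mulr_ge0 //; lra.
  have dw : d * w e <= k * w e by rewrite ler_pM2r //; lra.
  have unseen v : v \notin cover (Mstar :&: P) -> Num.min (charge L v) (k * w e) = 0.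
    by move=> nv; rewrite (inv_unseen inv nv) min_l // mulr_ge0 // ltW.
  have full v : Num.min (charge L v) (k * w e) <= k * w e by rewrite ge_min lexx orbT.
  have ends (F : T -> R) : \sum_(v in e) F v = F x + F y by rewrite ee sum_ends.
  rewrite !ends px py /credit px py.
  (* An end that no optimal edge has reached bears no charge. This alone saves [k * w e], more than
     the required [d * w e]. *)
  have [xS|/unseen ->] := boolP (x \in _); have [yS|/unseen ->] := boolP (y \in _).
  - have slackE v : Num.max 0 (k * w e - charge L v) = k * w e - Num.min (charge L v) (k * w e).
      by minmax.
    rewrite !slackE; lra.
  - have := full x; lra.
  - have := full y; lra.
  - have : 0 <= k * w e by rewrite mulr_ge0 // ltW.
    lra.
have := bal_total bL; rewrite -/M; lra.
Qed.

Lemma optimal_exists st o : exists A, optimal E w k st o A.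
Proof.
pose adm B := augmenting E (current st) B && (B \subset candidates st o).
have adm0 : adm set0 by rewrite /adm augmenting0 sub0set.
case: (Order.TotalTheory.arg_maxP (gain w k (current st)) adm0) => A admA best.
by exists A; split=> // B /best.
Qed.

Lemma run_exists s st : exists st', run E w k st s st'.
Proof.
elim: s st => [|o s IH] st; first by exists st.
have [A opt] := optimal_exists st o.
have [st' r] := IH (if 0 < gain w k (current st) A then augment st A else st).
exists st'; exists (if 0 < gain w k (current st) A then augment st A else st) => //.
by exists A.
Qed.

End Run.

Theorem theorem3 (R : realFieldType) (T : finType) (E : {set {set T}})
    (w : {set T} -> R) (k : R) (s : seq {set T})
    (simpleE : simple_graph E)
    (w_gt0 : forall e, e \in E -> 0 < w e)
    (k_gt1 : 1 < k)
    (uniq_s : uniq s) (s_E : s =i E) :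
  (exists M, shadow_matching E w k s M) /\
  (forall M, shadow_matching E w k s M ->
     matching E M /\
     forall Mstar, max_weight_matching E w Mstar ->
       weight w Mstar <=
         (k + k / (k - 1) + (k ^+ 3 - k + 1) / k ^+ 2) * weight w M).
Proof.
have k0 : 0 < k := lt_trans ltr01 k_gt1.
split; first by have [st r] := run_exists E w k s (initial T); exists (current st), st.
move=> M [st r ->]; pose d := (k - 1) / k ^+ 2.
have kd : rate k d by split=> //; rewrite /d divfK // expf_neq0 // gt_eqF.
have final Mstar : matching E Mstar ->
    exists L, invariant E w k d Mstar (set0 :|: [set o in s]) st L.
  move=> mMs; have [L inv] := initial_invariant E w k d Mstar.
  apply: (run_invariant simpleE w_gt0 kd mMs inv uniq_s _ r) => o.
  by rewrite s_E inE.
split=> [|Mstar [mMs _]].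
  (* The invariant requires some reference matching, and the empty one suffices to see that the
     output is a matching. *)
  by have [|L inv] := final set0; [apply/matchingP; rewrite sub0set; split=> // e f v; rewrite inE
    | apply: inv_matching inv].
have [L inv] := final _ mMs.
have sub : Mstar \subset set0 :|: [set o in s].
  by apply/subsetP => e /(matching_edge mMs); rewrite !inE s_E.
have -> : k + k / (k - 1) + (k ^+ 3 - k + 1) / k ^+ 2 = 2 * k - d + k / (k - 1).
  by rewrite /d; field; rewrite !gt_eqF ?subr_gt0.
exact: (invariant_bound simpleE w_gt0 kd mMs inv sub).
Qed.
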